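(* Let $(\mathcal{M},\tau,\Delta,R)$ be a finite-dimensional normalized quantum hypergroup such that the trace $\tau$ is normalized ($\tau(1)=1$). Let $f\in\mathcal{M}$. Suppose that the convolution map $T\colon L^1(\mathcal{M})\to L^1(\mathcal{M})$, $x\mapsto f*x$ is a quantum channel. Then the classical capacity of $T$ satisfies $$C(T)\le -H(f)=\tau(f\log_2 f).$$
   Context: A finite-dimensional normalized quantum hypergroup $(\mathcal{M},\tau,\Delta,R)$ consists of a finite-dimensional von Neumann algebra $\mathcal{M}$ with a faithful trace $\tau$, a unital completely positive map $\Delta\colon\mathcal{M}\to\mathcal{M}\otimes\mathcal{M}$ with $(\Delta\otimes\mathrm{Id})\Delta=(\mathrm{Id}\otimes\Delta)\Delta$, and a trace-preserving involutive $*$-antiautomorphism $R$ of $\mathcal{M}$ such that $\tau[(h*f)R(g)]=\tau[(f*g)R(h)]$ for all $f,g,h\in\mathcal{M}$. Here the convolution $f*g$ is determined by $\tau\big((f*g)R(h)\big)=(\tau\otimes\tau)\big[(R(g)\otimes R(f))\Delta(h)\big]$ for all $h\in\mathcal{M}$. $L^1(\mathcal{M})$ is $\mathcal{M}$ with norm $\tau(|x|)$, identified with the predual of $\mathcal M$. A quantum channel is a trace-preserving completely positive map between $L^1$-spaces. For $\rho\ge0$ with $\tau(\rho)=1$, the Segal entropy is $H(\rho)=-\tau(\rho\log_2\rho)$ (with $0\log 0=0$). Classical capacity: a value $\alpha\ge0$ is an achievable rate for classical information transmission through $T$ if $\alpha=0$, or $\alpha>0$ and for every $\varepsilon>0$,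 for all but finitely many positive integers $n$ and for $m=\lfloor\alpha n\rfloor$, there exist quantum channels $\Phi_1\colon\ell^1_{2^m}\to L^1(\mathcal{M}^{\otimes n})$ and $\Phi_2\colon L^1(\mathcal{M}^{\otimes n})\to\ell^1_{2^m}$ with $\|\mathrm{Id}_{\ell^1_{2^m}}-\Phi_2T^{\otimes n}\Phi_1\|_{\mathrm{cb},\ell^1_{2^m}\to\ell^1_{2^m}}<\varepsilon$. $C(T)$ is the supremum of all achievable rates.
   Formalization: The formal theorem adds the hypothesis f ≥ 0, without which H(f) and f log₂ f are undefined; it does not follow from T being a channel (e.g. Δ(h)=τ(h)1⊗1 with any f of trace 1). *)

(* Defs.v *)
From HB Require Import structures.
From mathcomp Require Import all_boot all_order all_algebra.
From mathcomp Require Import complex mxtens.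
From mathcomp Require Import all_classical all_reals all_analysis.

Set Implicit Arguments.
Unset Strict Implicit.
Unset Printing Implicit Defensive.
Import Order.TTheory GRing.Theory Num.Theory.

Local Open Scope classical_set_scope.
Local Open Scope ring_scope.
Local Open Scope sesquilinear_scope.
Local Open Scope complex_scope.

Section Operators.
Variable R : realType.
Local Notation C := R[i].

(* In the order of [R[i]], [0 <= z] says that z is real and nonnegative. *)
Definition psdmx d (X : 'M[C]_d) : Prop :=
  forall v : 'cV[C]_d, 0 <= (v^t* *m X *m v) 0 0.

Definition vnorm d (v : 'cV[C]_d) : R :=
  Num.sqrt (\sum_i ComplexField.Normc.normc (v i 0) ^+ 2).

Definition opnorm d (X : 'M[C]_d) : \bar R :=
  ereal_sup [set (vnorm (X *m v))%:E | v in [set v : 'cV[C]_d | vnorm v <= 1]].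

(* The k x k matrix of operators X, as one operator on C^k (x) C^d. *)
Definition blockmx k d (X : 'M['M[C]_d]_k) : 'M[C]_(k * d) :=
  \sum_i \sum_j (delta_mx i j : 'M[C]_k) *t X i j.

(* Functional calculus, meaningful for Hermitian X: the eigenvalues are then
   real, so that taking their real parts loses nothing. *)
Definition funcalc (g : R -> R) d (X : 'M[C]_d) : 'M[C]_d :=
  invmx (spectralmx X)
    *m diag_mx (map_mx (fun z => (g (complex.Re z))%:C) (spectral_diag X))
    *m spectralmx X.

(* [ln 0 = 0] in the library, hence [x * log2 x = 0] at [x = 0]. *)
Definition log2 (x : R) : R := ln x / ln 2.

End Operators.

(* A linear subspace of M_d(C) with a functional on it; the axioms are stated
   separately, in [is_vna] and [is_faithful_trace]. *)
Record tvna (R : realType) := TVna {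
  tdim : nat;
  tcarrier : {vspace 'M[R[i]]_tdim};
  ttrace : subvs_of tcarrier -> R[i] }.

Definition elt (R : realType) (M : tvna R) : Type := subvs_of (tcarrier M).
Coercion elt : tvna >-> Sortclass.
Definition tau (R : realType) (M : tvna R) (x : M) : R[i] := ttrace x.
Definition opof (R : realType) (M : tvna R) (x : M) : 'M[R[i]]_(tdim M) :=
  vsval x.
(* The projection [vsproj] is the identity on the carrier. *)
Definition toelt (R : realType) (M : tvna R) (X : 'M[R[i]]_(tdim M)) : M :=
  vsproj (tcarrier M) X.
Arguments toelt {R} M X.

Section Algebra.
Variables (R : realType) (M : tvna R).

Definition vone : M := toelt M 1%:M.
Definition vmul (x y : M) : M := toelt M (opof x *m opof y).
Definition vadj (x : M) : M := toelt M ((opof x)^t*).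
Definition vpos (x : M) : Prop := psdmx (opof x).

(* Up to isomorphism, the finite-dimensional von Neumann algebras are the unital
   *-subalgebras of the M_d(C). *)
Definition is_vna : Prop :=
  [/\ 1%:M \in tcarrier M,
      (forall x y : M, opof x *m opof y \in tcarrier M) &
      (forall x : M, (opof x)^t* \in tcarrier M)].

Definition is_faithful_trace : Prop :=
  [/\ scalar (@tau R M),
      (forall x y : M, tau (vmul x y) = tau (vmul y x)),
      (forall x : M, vpos x -> 0 <= tau x) &
      (forall x : M, vpos x -> tau x = 0 -> x = 0)].

End Algebra.
Arguments vone {R} M.

Section Tensor.
Variable R : realType.
Implicit Types M N P Q : tvna R.

Definition tens_carrier M N : {vspace 'M[R[i]]_(tdim M * tdim N)} :=
  <<[seq a *t b | a <- vbasis (tcarrier M), b <- vbasis (tcarrier N)]>>%VS.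

(* tau_M (x) tau_N, read on the matrix units e_ij (x) e_kl after extending both
   traces to the full matrix algebras; see [tau_vtens]. *)
Definition tens_trace M N (X : subvs_of (tens_carrier M N)) : R[i] :=
  \sum_i \sum_j \sum_k \sum_l
    vsval X (mxtens_index (i, k)) (mxtens_index (j, l))
      * (tau (toelt M (delta_mx i j)) * tau (toelt N (delta_mx k l))).

Definition tens M N : tvna R := TVna (@tens_trace M N).

Definition vtens M N (x : M) (y : N) : tens M N :=
  toelt (tens M N) (opof x *t opof y).

(* phi (x) psi, in the same way; see [tens_map_vtens]. *)
Definition tens_map M N P Q (phi : M -> P) (psi : N -> Q) (X : tens M N) :
    tens P Q :=
  toelt (tens P Q) (\sum_i \sum_j \sum_k \sum_l
    opof X (mxtens_index (i, k)) (mxtens_index (j, l))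
      *: (opof (phi (toelt M (delta_mx i j)))
            *t opof (psi (toelt N (delta_mx k l))))).

Definition cplx : tvna R :=
  @TVna R 1 fullv (fun x => \tr (vsval x)).

Fixpoint tpow M n : tvna R := if n is n'.+1 then tens M (tpow M n') else cplx.

Fixpoint tpow_map M N (phi : M -> N) n : tpow M n -> tpow N n :=
  if n is n'.+1 then tens_map phi (@tpow_map M N phi n') else id.

(* l^oo_k acting diagonally on C^k, with the counting trace. *)
Definition ell (k : nat) : tvna R :=
  @TVna R k <<[seq delta_mx i i | i <- enum 'I_k]>>%VS
    (fun x => \tr (vsval x)).

End Tensor.
Arguments ell R k : clear implicits.

Section TensorFacts.
Variable R : realType.
Implicit Types M N P Q : tvna R.

Lemma opofK M (X : 'M[R[i]]_(tdim M)) :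
  X \in tcarrier M -> opof (toelt M X) = X.
Proof. exact: vsprojK. Qed.

Lemma toeltK M (x : M) : toelt M (opof x) = x.
Proof. exact: vsvalK. Qed.

Lemma tensmx_sum m n p q (I J : finType) (a : I -> R[i]) (b : J -> R[i])
    (A : I -> 'M[R[i]]_(m, n)) (B : J -> 'M[R[i]]_(p, q)) :
  (\sum_i a i *: A i) *t (\sum_j b j *: B j) =
  \sum_i \sum_j (a i * b j) *: (A i *t B j).
Proof.
apply/matrixP => k l.
rewrite !mxE !summxE big_distrl /=; apply: eq_bigr => i _.
rewrite summxE big_distrr /=; apply: eq_bigr => j _.
by rewrite !mxE mulrACA.
Qed.

Lemma linear_sumZ (U V : lmodType R[i]) (phi : U -> V) (I : finType)
    (a : I -> R[i]) (u : I -> U) :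
  linear phi -> phi (\sum_i a i *: u i) = \sum_i a i *: phi (u i).
Proof.
move=> lin; have phi0 : phi 0 = 0.
  by have := lin (-1) 0 0; rewrite scaler0 addr0 scaleN1r addNr.
elim/big_rec2: _ => [|i y1 y2 _ <-]; [exact: phi0 | exact: lin].
Qed.

Lemma opof_linear M : linear (@opof R M).
Proof. exact: linearP. Qed.

Lemma toelt_linear M : linear (toelt M).
Proof. exact: linearP. Qed.

Lemma linear_units M (V : lmodType R[i]) (phi : M -> V) (x : M) :
  linear phi ->
  phi x = \sum_i \sum_j opof x i j *: phi (toelt M (delta_mx i j)).
Proof.
move=> lin; rewrite pair_big /=.
rewrite -(linear_sumZ (fun p => opof x p.1 p.2) _ lin); congr (phi _).
rewrite -(linear_sumZ _ _ (@toelt_linear M)) -[LHS]toeltK.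
by congr (toelt M _); rewrite [LHS]matrix_sum_delta pair_big.
Qed.

Lemma mem_vtens M N (x : M) (y : N) :
  opof x *t opof y \in tens_carrier M N.
Proof.
rewrite /opof (coord_vbasis (valP x)) (coord_vbasis (valP y)) tensmx_sum.
apply: rpred_sum => i _; apply: rpred_sum => j _; apply/rpredZ/memv_span.
by apply: allpairs_f; apply: mem_nth; rewrite size_tuple.
Qed.

Lemma opof_vtens M N (x : M) (y : N) : opof (vtens x y) = opof x *t opof y.
Proof. exact/opofK/mem_vtens. Qed.

Lemma tau_vtens M N (x : M) (y : N) :
  scalar (@tau R M) -> scalar (@tau R N) ->
  tau (vtens x y) = tau x * tau y.
Proof.
move=> tM tN.
rewrite (@linear_units M R[i]^o (@tau R M) x tM).
rewrite (@linear_units N R[i]^o (@tau R N) y tN).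
rewrite mulr_suml; apply: eq_bigr => i _.
rewrite mulr_suml; apply: eq_bigr => j _.
rewrite mulr_sumr; apply: eq_bigr => k _.
rewrite mulr_sumr; apply: eq_bigr => l _.
by rewrite -/(opof (vtens x y)) opof_vtens tensmxE mulrACA.
Qed.

Lemma tens_map_vtens M N P Q (phi : M -> P) (psi : N -> Q) (x : M) (y : N) :
  linear phi -> linear psi ->
  tens_map phi psi (vtens x y) = vtens (phi x) (psi y).
Proof.
have units (A B : tvna R) (chi : A -> B) (z : A) : linear chi ->
    opof (chi z) =
    \sum_p opof z p.1 p.2 *: opof (chi (toelt A (delta_mx p.1 p.2))).
  move=> lin; rewrite (linear_units z lin) pair_big /=.
  exact: (linear_sumZ _ _ (@opof_linear B)).
move=> lphi lpsi; rewrite /vtens (units _ _ _ x lphi) (units _ _ _ y lpsi).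
congr (toelt (tens P Q) _).
rewrite tensmx_sum pair_big; apply: eq_bigr => -[i j] _ /=.
rewrite pair_big; apply: eq_bigr => -[k l] _ /=.
by rewrite -/(vtens x y) opof_vtens tensmxE.
Qed.

End TensorFacts.

Section Channels.
Variable R : realType.
Implicit Types M N : tvna R.

Definition block M k (x : 'M[M]_k) : 'M[R[i]]_(k * tdim M) :=
  blockmx (map_mx (@opof R M) x).

Definition completely_positive M N (phi : M -> N) : Prop :=
  linear phi /\
  forall k (x : 'M[M]_k), psdmx (block x) -> psdmx (block (map_mx phi x)).

Definition quantum_channel M N (phi : M -> N) : Prop :=
  completely_positive phi /\ forall x : M, tau (phi x) = tau x.

(* An operator space structure on E is given by its norms on the M_k(E). *)
Definition mxnorms (E : Type) := forall k, 'M[E]_k -> \bar R.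

Definition cbnorm (E F : Type) (nE : mxnorms E) (nF : mxnorms F)
    (phi : E -> F) : \bar R :=
  ereal_sup [set y | exists k (x : 'M[E]_k),
    (nE k x <= 1%E)%E /\ y = nF k (map_mx phi x)].

Definition mx_mxnorms d : mxnorms 'M[R[i]]_d := fun k X => opnorm (blockmx X).

Definition Loo_mxnorms M : mxnorms M := fun k x => opnorm (block x).

(* The operator space structure of L^1(M) as the predual of M: the norm of
   M_k(L^1(M)) is that of CB(M, M_k), with x in L^1(M) acting on M as
   h |-> tau(x h). *)
Definition L1_mxnorms M : mxnorms M := fun k x =>
  cbnorm (@Loo_mxnorms M) (@mx_mxnorms k)
    (fun h : M => \matrix_(i, j) tau (vmul (x i j) h)).

Definition cbnorm_L1 M N (phi : M -> N) : \bar R :=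
  cbnorm (@L1_mxnorms M) (@L1_mxnorms N) phi.

Definition xlog2x M (rho : M) : M :=
  toelt M (opof rho *m funcalc (@log2 R) (opof rho)).

Definition segal_entropy M (rho : M) : R := - complex.Re (tau (xlog2x rho)).

Definition achievable_rate M (T : M -> M) (alpha : R) : Prop :=
  alpha = 0 \/
  0 < alpha /\
  forall eps : R, 0 < eps -> \forall n \near \oo,
    let m := Num.truncn (alpha * n%:R) in
    exists (phi1 : ell R (2 ^ m)%N -> tpow M n)
           (phi2 : tpow M n -> ell R (2 ^ m)%N),
      [/\ quantum_channel phi1, quantum_channel phi2 &
          (cbnorm_L1 (fun x : ell R (2 ^ m)%N =>
             (x - phi2 (tpow_map T (phi1 x)))%R) < eps%:E)%E].

Definition classical_capacity M (T : M -> M) : \bar R :=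
  ereal_sup [set alpha%:E | alpha in achievable_rate T].

End Channels.

Section Hypergroup.
Variables (R : realType) (M : tvna R).
Variables (Delta : M -> tens M M) (S : M -> M).

(* The convolution f * g is determined by this since tau is faithful. *)
Definition is_convolution (conv : M -> M -> M) : Prop :=
  forall f g h : M,
    tau (vmul (conv f g) (S h)) = tau (vmul (vtens (S g) (S f)) (Delta h)).

(* The cast identifies C^d (x) (C^d (x) C^d) with (C^d (x) C^d) (x) C^d. *)
Definition coassociative : Prop :=
  forall x : M,
    opof (tens_map Delta (@id M) (Delta x)) =
    castmx (mulnA _ _ _, mulnA _ _ _) (opof (tens_map (@id M) Delta (Delta x))).

Record quantum_hypergroup (conv : M -> M -> M) : Prop := QuantumHypergroup {
  qh_vna : is_vna M;
  qh_trace : is_faithful_trace M;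
  qh_Delta_cp : completely_positive Delta;
  qh_Delta_unital : Delta (vone M) = vone (tens M M);
  qh_Delta_coassoc : coassociative;
  qh_S_linear : linear S;
  qh_S_involutive : involutive S;
  qh_S_anti : forall x y : M, S (vmul x y) = vmul (S y) (S x);
  qh_S_adj : forall x : M, S (vadj x) = vadj (S x);
  qh_S_trace : forall x : M, tau (S x) = tau x;
  qh_conv : is_convolution conv;
  qh_cyclic : forall f g h : M,
    tau (vmul (conv h f) (S g)) = tau (vmul (conv f g) (S h)) }.

End Hypergroup.

(* Main.v *)
Require Import Defs.
From mathcomp Require Import all_boot all_order all_algebra.
From mathcomp Require Import complex mxtens ring lra.
From mathcomp Require Import all_classical all_reals all_analysis.

(** Since [tau 1 = 1], a code for [T^{(x)n}] contains a codeword [x] whose decoding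
    functional [eta = (phi2 _)_xx <= tau] satisfies [eta 1 <= 2^-m] although
    [eta (T^{(x)n} rho) >= 1 - eps] for the corresponding input state [rho].  To turn
    this into an entropy bound, write [f = sum_i lam_i P_i] spectrally.  The maps
    [conv P_i] are completely positive, scale the trace by [tau P_i], and sum to
    [conv 1 = tau(_) 1].  Taking tensor products,
    [T^{(x)n} = sum_j L_j Psi_j] with completely positive [Psi_j] that scale the trace
    by weights [w_j], [sum_j Psi_j = tau(_) 1], and
    [sum_j w_j L_j log2 L_j = n tau(f log2 f)].  The numbers
    [u_j = eta (Psi_j rho)] then satisfy [0 <= u_j <= w_j], [sum_j u_j <= 2^-m] and
    [sum_j L_j u_j >= 1 - eps], so that Young's inequality for [x ln x] gives
    [(1 - eps) m <= n tau(f log2 f) + 1 / ln 2]. *)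

Set Implicit Arguments.
Unset Strict Implicit.
Unset Printing Implicit Defensive.
Import Order.TTheory GRing.Theory Num.Theory.
Local Open Scope ring_scope.

(** * Positive kernels *)

Section PositiveKernels.
Variable C : numClosedFieldType.

(** Indices range over an arbitrary finite type, so that block and tensor indices can be regrouped
    by reindexing alone. *)
Definition psdker (T : finType) (K : T -> T -> C) :=
  forall v : T -> C, 0 <= \sum_s \sum_t (v s)^* * K s t * v t.

Lemma eq_psdker (T : finType) (K L : T -> T -> C) :
  (forall s t, K s t = L s t) -> psdker K -> psdker L.
Proof.
move=> eqKL psdK v; have := psdK v.
by under eq_bigr do under eq_bigr do rewrite eqKL.
Qed.

(** The form of the pulled-back kernel at [v] is the form of [K] at the push-forward of [v] along
    [h], so [h] may repeat or omit indices. *)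
Lemma psdker_comp (T U : finType) (h : U -> T) (K : T -> T -> C) :
  psdker K -> psdker (fun s t => K (h s) (h t)).
Proof.
move=> psdK v; have := psdK (fun s => \sum_(u | h u == s) v u).
congr (0 <= _).
rewrite [RHS](partition_big h predT) //=; apply: eq_bigr => s _.
rewrite exchange_big [RHS]/=.
rewrite (eq_bigr (fun t => \sum_(u | h u == t) \sum_(i | h i == s)
   (v i)^* * K (h i) (h u) * v u)).
  by rewrite [RHS](partition_big h predT).
move=> t _; rewrite mulr_sumr; apply: eq_bigr => u /eqP ht.
rewrite rmorph_sum !mulr_suml; apply: eq_bigr => i /eqP hs.
by rewrite hs ht.
Qed.

End PositiveKernels.

Section Psd.
Variable R : realType.
Local Notation C := R[i].
Local Open Scope sesquilinear_scope.

Lemma psdmxE d (X : 'M[C]_d) : psdmx X <-> psdker (fun i j => X i j).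
Proof.
have qE (v : 'cV[C]_d) : (v^t* *m X *m v) 0 0 =
    \sum_i \sum_j (v i 0)^* * X i j * v j 0.
  rewrite mxE exchange_big; apply: eq_bigr => j _.
  by rewrite mxE mulr_suml; apply: eq_bigr => i _; rewrite !mxE.
split=> psdX v; last by rewrite qE; exact: psdX (fun i => v i 0).
have := psdX (\col_i v i); rewrite qE; congr (0 <= _).
by apply: eq_bigr => i _; apply: eq_bigr => j _; rewrite !mxE.
Qed.

Lemma blockmxE k d (X : 'M['M[C]_d]_k) i j a b :
  blockmx X (mxtens_index (i, a)) (mxtens_index (j, b)) = X i j a b.
Proof.
have E i' j' : (delta_mx i' j' *t X i' j' : 'M[C]_(k * d))
    (mxtens_index (i, a)) (mxtens_index (j, b)) =
    ((i == i') && (j == j'))%:R * X i' j' a b by rewrite tensmxE mxE.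
rewrite /blockmx summxE (bigD1 i) //= summxE (bigD1 j) //= E !eqxx mul1r.
rewrite -[RHS]addr0 -addrA; congr (_ + _); rewrite -[RHS]addr0; congr (_ + _).
  by apply: big1 => j' ne; rewrite E eqxx eq_sym (negPf ne) mul0r.
apply: big1 => i' ne; rewrite summxE; apply: big1 => j' _.
by rewrite E eq_sym (negPf ne) mul0r.
Qed.

(** Complete positivity with blocks indexed by any finite type [I]; the matrix index of a tensor leg
    can then be absorbed into the block index. *)
Definition cp_kernel (M N : tvna R) (phi : M -> N) :=
  forall (I : finType) (x : I -> I -> M),
    psdker (fun s t : I * _ => opof (x s.1 t.1) s.2 t.2) ->
    psdker (fun s t : I * _ => opof (phi (x s.1 t.1)) s.2 t.2).

Lemma psdmx_block (M : tvna R) k (x : 'M[M]_k) :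
  psdmx (block x) <-> psdker (fun s t : 'I_k * _ => opof (x s.1 t.1) s.2 t.2).
Proof.
rewrite psdmxE; split=> [/(psdker_comp (@mxtens_index _ _))|].
  by apply: eq_psdker => -[i a] [j b] /=; rewrite blockmxE mxE.
move=> /(psdker_comp (@mxtens_unindex _ _)); apply: eq_psdker => s t.
rewrite -[in RHS](mxtens_unindexK s) -[in RHS](mxtens_unindexK t).
case: (mxtens_unindex s) (mxtens_unindex t) => i a [j b] /=.
by rewrite [RHS]blockmxE mxE.
Qed.

Lemma cp_kernelP (M N : tvna R) (phi : M -> N) :
  completely_positive phi -> cp_kernel phi.
Proof.
move=> [_ cp] I x psdx.
have := cp #|I| (\matrix_(i, j) x (enum_val i) (enum_val j)).
rewrite !psdmx_block => /(_ _) h.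
apply: (@eq_psdker _ _ (fun s t : I * _ => opof (map_mx phi
  (\matrix_(i, j) x (enum_val i) (enum_val j)) (enum_rank s.1) (enum_rank t.1))
    s.2 t.2)).
  by move=> s t; rewrite !mxE !enum_rankK.
apply: (psdker_comp (fun s : I * _ => (enum_rank s.1, s.2))
  (K := fun s t => opof (map_mx phi _ s.1 t.1) s.2 t.2)).
apply: h; apply: eq_psdker (psdker_comp
  (fun s : 'I_#|I| * _ => (enum_val s.1, s.2)) psdx) => s t /=.
by rewrite mxE.
Qed.

Lemma cp_kernel_pos (M N : tvna R) (phi : M -> N) (x : M) :
  cp_kernel phi -> vpos x -> vpos (phi x).
Proof.
move=> cp /psdmxE psdx; apply/psdmxE.
have := cp unit (fun _ _ => x) (psdker_comp snd psdx).
by move/(psdker_comp (fun i => (tt, i))).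
Qed.

End Psd.

(** * Slices and tensor products of maps *)

Section Tensor.
Variable R : realType.
Local Notation C := R[i].
Implicit Types M N P Q : tvna R.

(** Elementary tensors of basis elements span the carrier, so linear identities on a tensor product
    need checking only on [vtens x y]. *)
Lemma tens_ext M N (V : lmodType C) (F G : tens M N -> V) :
  linear F -> linear G -> (forall x y, F (vtens x y) = G (vtens x y)) ->
  F =1 G.
Proof.
move=> lF lG eqFG Z.
pose S := [seq a *t b | a <- vbasis (tcarrier M), b <- vbasis (tcarrier N)].
have Zspan : opof Z \in <<in_tuple S>>%VS by exact: valP Z.
have ES (i : 'I_(size S)) : exists x y, toelt (tens M N) S`_i = vtens x y.
  have /allpairsP[[a b] /= [/vbasis_mem aM /vbasis_mem bN ->]] : S`_i \in S.
    exact: mem_nth.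
  by exists (toelt M a), (toelt N b); rewrite /vtens !opofK.
have -> : Z = \sum_(i < size S)
    coord (in_tuple S) i (opof Z) *: toelt (tens M N) S`_i.
  rewrite -(linear_sumZ _ _ (@toelt_linear R (tens M N))) -[LHS]toeltK.
  by congr toelt; exact: coord_span.
rewrite !linear_sumZ //; apply: eq_bigr => i _.
by have [x [y ->]] := ES i; rewrite eqFG.
Qed.

Lemma vtens_linear_l M N (y : N) : linear (fun x : M => vtens x y).
Proof.
move=> c u v; rewrite /vtens -toelt_linear; congr toelt.
by apply/matrixP => i j; rewrite !mxE mulrDl mulrA.
Qed.

Lemma vtens_linear_r M N (x : M) : linear (fun y : N => vtens x y).
Proof.
move=> c u v; rewrite /vtens -toelt_linear; congr toelt.
by apply/matrixP => i j; rewrite !mxE mulrDr mulrCA.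
Qed.

(** The slice map that applies to the second leg the functional reading entry [(k, l)]. The
    projection in [toelt] changes nothing, as [opof_lslice] shows. *)
Definition lslice M N (k l : 'I_(tdim N)) (Z : tens M N) : M :=
  toelt M (\matrix_(i, j)
    opof Z (mxtens_index (i, k)) (mxtens_index (j, l))).

Definition rslice M N (i j : 'I_(tdim M)) (Z : tens M N) : N :=
  toelt N (\matrix_(k, l)
    opof Z (mxtens_index (i, k)) (mxtens_index (j, l))).

Lemma lslice_linear M N k l : linear (@lslice M N k l).
Proof.
move=> c X Y; rewrite /lslice -toelt_linear; congr toelt.
by apply/matrixP => i j; rewrite opof_linear !mxE.
Qed.

Lemma rslice_linear M N i j : linear (@rslice M N i j).
Proof.
move=> c X Y; rewrite /rslice -toelt_linear; congr toelt.
by apply/matrixP => k l; rewrite opof_linear !mxE.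
Qed.

Lemma lslice_vtens M N k l (x : M) (y : N) :
  lslice k l (vtens x y) = opof y k l *: x.
Proof.
rewrite -[x in RHS]toeltK -[RHS](linearZ_LR (vsproj (tcarrier M))).
by congr toelt; apply/matrixP => i j; rewrite opof_vtens !mxE !mxtens_indexK mulrC.
Qed.

Lemma rslice_vtens M N i j (x : M) (y : N) :
  rslice i j (vtens x y) = opof x i j *: y.
Proof.
rewrite -[y in RHS]toeltK -[RHS](linearZ_LR (vsproj (tcarrier N))).
by congr toelt; apply/matrixP => k l; rewrite opof_vtens !mxE !mxtens_indexK.
Qed.

Lemma opof_entry_linear M i j : linear (fun x : M => opof x i j : C^o).
Proof. by move=> c x y; rewrite opof_linear !mxE. Qed.

Lemma opof_lslice M N k l (Z : tens M N) i j :
  opof (lslice k l Z) i j = opof Z (mxtens_index (i, k)) (mxtens_index (j, l)).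
Proof.
move: Z; apply: (tens_ext (V := C^o)) => [c X Y|c X Y|x y].
- by rewrite lslice_linear opof_entry_linear.
- by rewrite opof_entry_linear.
- by rewrite lslice_vtens opof_vtens tensmxE /opof linearZ mxE mulrC.
Qed.

Lemma opof_rslice M N i j (Z : tens M N) k l :
  opof (rslice i j Z) k l = opof Z (mxtens_index (i, k)) (mxtens_index (j, l)).
Proof.
move: Z; apply: (tens_ext (V := C^o)) => [c X Y|c X Y|x y].
- by rewrite rslice_linear opof_entry_linear.
- by rewrite opof_entry_linear.
- by rewrite rslice_vtens opof_vtens tensmxE /opof linearZ mxE.
Qed.

Lemma tens_map_linear M N P Q (phi : M -> P) (psi : N -> Q) :
  linear (tens_map phi psi).
Proof.
move=> c X Y; rewrite /tens_map -toelt_linear; congr toelt.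
rewrite scaler_sumr -big_split; apply: eq_bigr => i _ /=.
rewrite scaler_sumr -big_split; apply: eq_bigr => j _ /=.
rewrite scaler_sumr -big_split; apply: eq_bigr => k _ /=.
rewrite scaler_sumr -big_split; apply: eq_bigr => l _ /=.
by rewrite !mxE scalerDl scalerA.
Qed.

Lemma linear_scale (U V : lmodType C) (phi : U -> V) c u :
  linear phi -> phi (c *: u) = c *: phi u.
Proof.
move=> lin; have phi0 : phi 0 = 0.
  by have := lin (-1) 0 0; rewrite scaler0 addr0 scaleN1r addNr.
by have := lin c u 0; rewrite phi0 !addr0.
Qed.

Lemma opof_tens_map_l M N P (phi : M -> P) (Z : tens M N) i j k l :
  linear phi ->
  opof (tens_map phi (@id N) Z) (mxtens_index (i, k)) (mxtens_index (j, l)) =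
  opof (phi (lslice k l Z)) i j.
Proof.
move=> lphi; move: Z; apply: (tens_ext (V := C^o)) => [c X Y|c X Y|x y].
- by rewrite tens_map_linear opof_entry_linear.
- by rewrite lslice_linear lphi opof_entry_linear.
- rewrite tens_map_vtens // opof_vtens tensmxE lslice_vtens linear_scale //.
  by rewrite /opof linearZ mxE mulrC.
Qed.

Lemma opof_tens_map_r M N Q (psi : N -> Q) (Z : tens M N) i j k l :
  linear psi ->
  opof (tens_map (@id M) psi Z) (mxtens_index (i, k)) (mxtens_index (j, l)) =
  opof (psi (rslice i j Z)) k l.
Proof.
move=> lpsi; move: Z; apply: (tens_ext (V := C^o)) => [c X Y|c X Y|x y].
- by rewrite tens_map_linear opof_entry_linear.
- by rewrite rslice_linear lpsi opof_entry_linear.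
- rewrite tens_map_vtens // opof_vtens tensmxE rslice_vtens linear_scale //.
  by rewrite /opof linearZ mxE.
Qed.

Lemma tens_map_comp M N P Q (phi : M -> P) (psi : N -> Q) :
  linear phi -> linear psi ->
  tens_map phi psi =1 tens_map phi (@id Q) \o tens_map (@id M) psi.
Proof.
move=> lphi lpsi; apply: tens_ext => [||x y /=].
- exact: tens_map_linear.
- by move=> c X Y /=; rewrite !tens_map_linear.
- by rewrite !tens_map_vtens.
Qed.

(** Factor the map as [psi] on the right leg followed by [phi] on the left leg. Each factor acts
    slice by slice, and the matrix index of the idle leg joins the block index, so complete
    positivity of [psi] and then of [phi] applies. *)
Lemma cp_kernel_tens_map M N P Q (phi : M -> P) (psi : N -> Q) :
  linear phi -> linear psi -> cp_kernel phi -> cp_kernel psi ->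
  cp_kernel (tens_map phi psi).
Proof.
move=> lphi lpsi cphi cpsi I x psdx.
pose y (a b : I) : tens M Q := tens_map (@id M) psi (x a b).
have psdx' : psdker (fun s t : (I * 'I_(tdim M)) * 'I_(tdim N) =>
    opof (rslice s.1.2 t.1.2 (x s.1.1 t.1.1)) s.2 t.2).
  apply: eq_psdker (psdker_comp (fun s : (I * 'I_(tdim M)) * 'I_(tdim N) =>
    (s.1.1, mxtens_index (s.1.2, s.2))) psdx) => s t /=.
  by rewrite opof_rslice.
have psdy := cpsi _ (fun p q => rslice p.2 q.2 (x p.1 q.1)) psdx'.
have psdy' : psdker (fun s t : (I * 'I_(tdim Q)) * 'I_(tdim M) =>
    opof (lslice s.1.2 t.1.2 (y s.1.1 t.1.1)) s.2 t.2).
  apply: eq_psdker (psdker_comp (fun s : (I * 'I_(tdim Q)) * 'I_(tdim M) =>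
    ((s.1.1, s.2), s.1.2)) psdy) => s t /=.
  by rewrite opof_lslice opof_tens_map_r.
have psdz := cphi _ (fun p q => lslice p.2 q.2 (y p.1 q.1)) psdy'.
apply: eq_psdker (psdker_comp (fun s : I * 'I_(tdim P * tdim Q) =>
  ((s.1, (mxtens_unindex s.2).2), (mxtens_unindex s.2).1)) psdz) => s t /=.
rewrite [in RHS]tens_map_comp // -[s.2 in RHS]mxtens_unindexK.
by rewrite -[t.2 in RHS]mxtens_unindexK opof_tens_map_l.
Qed.

End Tensor.

(** * Spectral resolution *)

Section FunctionalCalculus.
Variable R : realType.
Local Notation C := R[i].
Local Open Scope sesquilinear_scope.

(** Polarization: positivity makes the quadratic form real, and its being real at [e_j + e_i] and at
    [e_j + i e_i] forces the entries [(i, j)] and [(j, i)] to be conjugate. *)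
Lemma psdmx_hermitian d (X : 'M[C]_d) : psdmx X -> X^t* = X.
Proof.
move=> psdX.
pose B (u v : 'cV[C]_d) := (u^t* *m X *m v) 0 0.
have Breal v : Num.conj (B v v) = B v v by apply/CrealP/ger0_real/psdX.
have BE i j : B (delta_mx i 0) (delta_mx j 0) = X i j.
  by rewrite /B trmx_delta map_delta_mx -rowE -colE !mxE.
have Bquad c i j : B (delta_mx i 0 + c *: delta_mx j 0)
    (delta_mx i 0 + c *: delta_mx j 0) =
    X i i + c * X i j + (c^* * X j i + `|c| ^+ 2 * X j j).
  have adjE (u v : 'cV[C]_d) : (u + c *: v)^t* = u^t* + Num.conj c *: v^t*.
    by apply/matrixP => a b; rewrite !mxE rmorphD rmorphM.
  rewrite -!BE /B adjE !(mulmxDl, mulmxDr) -!(scalemxAl, scalemxAr) !mxE normCK.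
  ring.
have Xii i : Num.conj (X i i) = X i i by rewrite -BE.
apply/matrixP => i j; rewrite !mxE.
have E1 := Breal (delta_mx j 0 + 1 *: delta_mx i 0).
have E2 := Breal (delta_mx j 0 + 'i%R *: delta_mx i 0).
move: E1 E2; rewrite !Bquad !(rmorphD, rmorphM, rmorphXn) /= !Xii.
rewrite !conjCK !conjCi normCi normr1 !conjC1.
move=> E1 E2.
have {}E1 : (X j i)^* + (X i j)^* = X j i + X i j.
  move: E1; rewrite !mul1r !expr1n !mul1r.
  by rewrite -!addrA => /addrI; rewrite !addrA => /addIr.
have {}E2 : - 'i%R * ((X j i)^* - (X i j)^* + (X j i - X i j)) = 0.
  move: E2 => /eqP; rewrite -subr_eq0 => /eqP <-; rewrite expr1n; ring.
move: E2 => /eqP; rewrite mulf_eq0 oppr_eq0 (negPf (neq0Ci _)) /= => /eqP E2.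
apply: (@mulfI _ 2); first by rewrite pnatr_eq0.
transitivity ((X j i)^* + (X i j)^* + ((X j i)^* - (X i j)^*)); first ring.
rewrite E1; move: E2 => /eqP; rewrite addr_eq0 => /eqP ->; ring.
Qed.

End FunctionalCalculus.

Section SpectralResolution.
Variable R : realType.
Local Notation C := R[i].
Local Open Scope sesquilinear_scope.
Local Open Scope complex_scope.

Section UnitaryDiagonal.
Variables (d : nat) (U : 'M[C]_d) (e : 'I_d -> R).

(** Functional calculus in one fixed eigenbasis; for unitary [U] it turns the algebra of operators
    into the pointwise algebra of the functions [g]. *)
Definition udiag (g : R -> R) : 'M[C]_d :=
  U^t* *m diag_mx (\row_r (g (e r))%:C) *m U.

Lemma udiagE g a b : udiag g a b = \sum_r (U^t*) a r * (g (e r))%:C * U r b.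
Proof.
by rewrite /udiag mul_mx_diag mxE; apply: eq_bigr => r _; rewrite !mxE.
Qed.

Lemma eq_udiag g h : (forall r, g (e r) = h (e r)) -> udiag g = udiag h.
Proof.
move=> eqgh; apply/matrixP => a b; rewrite !udiagE.
by apply: eq_bigr => r _; rewrite eqgh.
Qed.

Lemma udiag_sum (I : finType) (c : I -> R) (g : I -> R -> R) :
  udiag (fun x => \sum_i c i * g i x) = \sum_i (c i)%:C *: udiag (g i).
Proof.
apply/matrixP => a b; rewrite udiagE summxE.
under [RHS]eq_bigr do rewrite mxE udiagE mulr_sumr.
rewrite exchange_big; apply: eq_bigr => r _ /=.
rewrite rmorph_sum mulr_sumr mulr_suml; apply: eq_bigr => i _ /=.
by rewrite rmorphM /=; ring.
Qed.

Lemma udiag_adj g : (udiag g)^t* = udiag g.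
Proof.
apply/matrixP => a b; rewrite [LHS]mxE [in LHS]mxE !udiagE rmorph_sum /=.
apply: eq_bigr => r _; rewrite !rmorphM /= !mxE conjCK.
have -> : Num.conj (g (e r))%:C = (g (e r))%:C.
  by apply/CrealP/complex_realP; exists (g (e r)).
ring.
Qed.

Hypothesis unitaryU : U \is unitarymx.

Lemma udiagM g h : udiag g *m udiag h = udiag (fun x => g x * h x).
Proof.
rewrite /udiag -!mulmxA [in LHS](mulmxA U) (unitarymxP unitaryU) mul1mx.
rewrite [in LHS](mulmxA (diag_mx _)) mulmx_diag.
congr (_ *m (diag_mx _ *m _)).
by apply/rowP => r; rewrite !mxE rmorphM.
Qed.

Lemma udiag1 : udiag (fun=> 1) = 1%:M.
Proof.
rewrite /udiag (_ : (\row_r _) = const_mx 1); last by apply/rowP => r; rewrite !mxE.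
by rewrite diag_const_mx mulmx1 -invmx_unitary // mulVmx ?unitarymx_unit.
Qed.

End UnitaryDiagonal.

Lemma psdmx_funcalc d (X : 'M[C]_d) : psdmx X ->
  exists (U : 'M[C]_d) (e : 'I_d -> R),
    [/\ U \is unitarymx, forall r, 0 <= e r, X = udiag U e id &
        forall g, funcalc g X = udiag U e g].
Proof.
move=> psdX.
have /orthomx_spectralP : X \is normalmx.
  by apply/normalmxP; rewrite psdmx_hermitian.
rewrite /funcalc.
move: (spectralmx X) (spectral_unitarymx X) (spectral_diag X) => U Uu D.
rewrite (invmx_unitary Uu) => XE.
(* The eigenvalue [D 0 r] is the quadratic form of [X] at the adjoint of row [r] of [U], a unit
   vector. *)
have D_ge0 r : 0 <= D 0 r.
  have -> : D 0 r = (((row r U)^t* )^t* *m X *m (row r U)^t* ) 0 0.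
    rewrite trmxCK XE !mulmxA -row_mul (unitarymxP Uu).
    rewrite -(row_mul r _ (diag_mx D)) mul1mx -row_mul mxE.
    under eq_bigr do rewrite mul_diag_mx !mxE -mulrA.
    rewrite -mulr_sumr.
    have := congr1 (fun A : 'M[C]_d => A r r) (unitarymxP Uu).
    rewrite !mxE eqxx => E.
    by rewrite (eq_bigr (fun j => U r j * (U^t* ) j r)) ?E ?mulr1 // => j _; rewrite !mxE.
  exact: psdX.
have DE r : D 0 r = (complex.Re (D 0 r))%:C by rewrite RRe_real ?ger0_real.
exists U, (fun r => complex.Re (D 0 r)); split.
- exact: Uu.
- by move=> r; have := D_ge0 r; rewrite DE ler0c.
- apply/matrixP => a b; rewrite udiagE {1}XE mul_mx_diag mxE.
  by apply: eq_bigr => r _; rewrite mxE /= -DE.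
- move=> g; apply/matrixP => a b; rewrite udiagE mul_mx_diag mxE.
  by apply: eq_bigr => r _; rewrite !mxE.
Qed.

Lemma vmul_linear_r (M : tvna R) (x : M) : linear (vmul x).
Proof.
move=> c y z; rewrite /vmul -toelt_linear opof_linear.
by rewrite mulmxDr scalemxAr.
Qed.

Lemma vmul_linear_l (M : tvna R) (y : M) : linear (fun x : M => vmul x y).
Proof.
move=> c x z; rewrite /vmul -toelt_linear opof_linear.
by rewrite mulmxDl scalemxAl.
Qed.

Section VnaFacts.
Variable M : tvna R.
Hypothesis vnaM : is_vna M.

Lemma opof_vone : opof (vone M) = 1%:M.
Proof. by case: vnaM => h _ _; exact: opofK. Qed.

Lemma opof_vmul (x y : M) : opof (vmul x y) = opof x *m opof y.
Proof. by case: vnaM => _ h _; exact: opofK. Qed.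

Lemma opof_vadj (x : M) : opof (vadj x) = (opof x)^t*.
Proof. by case: vnaM => _ _ h; exact: opofK. Qed.

Lemma opof_inj (x y : M) : opof x = opof y -> x = y.
Proof. exact: val_inj. Qed.

(** Each factor is an affine function of an element of the algebra, which is unital and closed under
    products. This serves to place Lagrange interpolation polynomials in [M]. *)
Lemma mem_udiag_prod (s : seq R) (U : 'M[C]_(tdim M)) e (a b : R -> R) :
  U \is unitarymx -> udiag U e id \in tcarrier M ->
  udiag U e (fun x => \prod_(m <- s) (a m * x + b m)) \in tcarrier M.
Proof.
move=> Uu XM; have oneM : 1%:M \in tcarrier M by case: vnaM.
elim: s => [|m s IH].
  rewrite (@eq_udiag _ _ _ _ (fun=> 1)) ?udiag1 // => r.
  by rewrite big_nil.
rewrite (@eq_udiag _ _ _ _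
    (fun x => (a m * x + b m) * \prod_(m <- s) (a m * x + b m))); last first.
  by move=> r; rewrite big_cons.
have affM : udiag U e (fun x => a m * x + b m) \in tcarrier M.
  pose c (i : bool) := if i then a m else b m.
  pose g (i : bool) (x : R) := if i then x else 1.
  rewrite (@eq_udiag _ _ _ _ (fun x => \sum_i c i * g i x)); last first.
    by move=> r; rewrite big_bool /= mulr1.
  rewrite udiag_sum big_bool.
  apply: rpredD; apply: rpredZ; first exact: XM.
  by rewrite /g udiag1.
rewrite -(udiagM e Uu) -(opofK affM) -(opofK IH) -opof_vmul.
exact: valP.
Qed.

(** The indicator of an eigenvalue agrees on the spectrum with a Lagrange interpolation polynomial,
    so the spectral projections of [f] belong to [M] and not only to the full matrix algebra. *)
Lemma spectral_resolution (f : M) : vpos f ->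
  exists (J : finType) (lam : J -> R) (P : J -> M),
  [/\ forall j, 0 <= lam j,
      forall j, opof (P j) *m opof (P j) = opof (P j) /\
                (opof (P j))^t* = opof (P j),
      \sum_j P j = vone M,
      f = \sum_j (lam j)%:C *: P j &
      xlog2x f = \sum_j (lam j * log2 (lam j))%:C *: P j].
Proof.
move=> Hf; rewrite /xlog2x.
have [U [e [Uu e_ge0 fE fcE]]] := psdmx_funcalc Hf.
(* One index per distinct eigenvalue, so that the interpolation denominators do not vanish. *)
pose s := undup [seq e r | r <- enum 'I_(tdim M)].
have es r : e r \in s by rewrite mem_undup; apply: map_f; rewrite mem_enum.
pose ind (l x : R) : R := (x == l)%:R.
have indM l : l \in s -> udiag U e (ind l) \in tcarrier M.
  move=> ls.
  (* The factors are [(x - m) / (l - m)] for the other eigenvalues [m], in the form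
     [a m * x + b m]. *)
  have := mem_udiag_prod (rem l s) (fun m => (l - m)^-1) (fun m => (l - m)^-1 * - m) Uu.
  move/(_ e); rewrite -fE => /(_ (valP f)).
  rewrite (@eq_udiag _ _ _ _ (ind l)) // => r.
  rewrite rem_filter ?undup_uniq // /ind.
  have [->|ne] := eqVneq (e r) l.
    rewrite big1_seq // => m /=; rewrite mem_filter => /andP[ml _].
    by rewrite -mulrDr mulVf // subr_eq0 eq_sym.
  apply/eqP; rewrite prodf_seq_eq0; apply/hasP; exists (e r) => /=.
    by rewrite mem_filter /= ne es.
  by rewrite -mulrDr subrr mulr0.
pose J : finType := seq_sub s.
pose P (j : J) : M := toelt M (udiag U e (ind (ssval j))).
have opP j : opof (P j) = udiag U e (ind (ssval j)).
  by apply: opofK; apply: indM; exact: ssvalP.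
(* The constant 1, the identity and [x log2 x] are the three instances needed below. *)
have opsum g : opof (\sum_j (g (ssval j))%:C *: P j) = udiag U e g.
  rewrite (linear_sumZ _ _ (@opof_linear _ M)).
  under eq_bigr do rewrite opP.
  rewrite -udiag_sum; apply: eq_udiag => r.
  rewrite (bigD1 (SeqSub (es r))) //= /ind eqxx mulr1 big1 ?addr0 // => j ne.
  rewrite (_ : (e r == ssval j) = false) ?mulr0 //.
  by apply: contraNF ne => /eqP E; apply/eqP/val_inj.
exists J, (@ssval _ s), P; split.
- move=> [l ls] /=; move: ls; rewrite mem_undup => /mapP[r _ ->].
  exact: e_ge0.
- move=> j; rewrite !opP (udiagM e Uu) udiag_adj; split; last by [].
  by apply: eq_udiag => r; rewrite /ind; case: (_ == _); rewrite ?mulr1 ?mulr0.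
- apply: opof_inj; rewrite opof_vone -(udiag1 e Uu) -opsum.
  by congr opof; apply: eq_bigr => j _; rewrite scale1r.
- by apply: opof_inj; rewrite (opsum id).
- rewrite fcE {1}fE (udiagM e Uu).
  by rewrite -(opsum (fun x => x * log2 x)) toeltK.
Qed.

End VnaFacts.
End SpectralResolution.

(** * Convolution maps *)

Section Hypergroup.
Variable R : realType.
Local Notation C := R[i].
Local Open Scope sesquilinear_scope.

Lemma vmul_vtens (M N : tvna R) (a c : M) (b d : N) : is_vna M -> is_vna N ->
  vmul (vtens a b) (vtens c d) = vtens (vmul a c) (vmul b d).
Proof.
move=> vM vN; rewrite [LHS]/vmul !opof_vtens tensmx_mul.
by rewrite -!opof_vmul.
Qed.

Lemma opof_vone_vtens (M N : tvna R) :
  opof (vone M) = 1%:M -> opof (vone N) = 1%:M ->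
  opof (vtens (vone M) (vone N)) = 1%:M.
Proof.
move=> M1 N1; rewrite opof_vtens M1 N1.
apply/matrixP => s t; rewrite -[s]mxtens_unindexK -[t]mxtens_unindexK.
rewrite tensmxE !mxE (can_eq (@mxtens_indexK _ _)) -pair_eqE /=.
by rewrite -natrM mulnb.
Qed.

Lemma vone_tens (M N : tvna R) :
  opof (vone M) = 1%:M -> opof (vone N) = 1%:M ->
  vone (tens M N) = vtens (vone M) (vone N).
Proof. by move=> M1 N1; rewrite -[RHS]toeltK opof_vone_vtens. Qed.

Lemma tau_tens_linear (M N : tvna R) : scalar (@tau R (tens M N)).
Proof.
move=> c X Y; rewrite /tau /= /tens_trace.
rewrite mulr_sumr -big_split; apply: eq_bigr => i _ /=.
rewrite mulr_sumr -big_split; apply: eq_bigr => j _ /=.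
rewrite mulr_sumr -big_split; apply: eq_bigr => k _ /=.
rewrite mulr_sumr -big_split; apply: eq_bigr => l _ /=.
by rewrite !mxE mulrDl -mulrA.
Qed.

Section FaithfulTrace.
Variable M : tvna R.
Hypotheses (vnaM : is_vna M) (trM : is_faithful_trace M).

Lemma tau_linear : scalar (@tau R M). Proof. by case: trM. Qed.

Lemma mulmx_adj_eq0 d (X : 'M[C]_d) : X *m X^t* = 0 -> X = 0.
Proof.
move=> XX0; apply/matrixP => i j; rewrite [RHS]mxE.
have := congr1 (fun A : 'M[C]_d => A i i) XX0; rewrite !mxE => /eqP.
rewrite psumr_eq0 => [/allP|k _]; last by rewrite !mxE mul_conjC_ge0.
move/(_ j); rewrite mem_index_enum => /(_ isT) /=.
by rewrite !mxE mul_conjC_eq0 => /eqP.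
Qed.

Lemma psdmx_conj d (X P : 'M[C]_d) : psdmx X -> psdmx (P^t* *m X *m P).
Proof.
move=> psdX v; have := psdX (P *m v); congr (0 <= _ 0 0).
by rewrite trmx_mul map_mxM !mulmxA.
Qed.

Lemma psdmx1 d : psdmx (1%:M : 'M[C]_d).
Proof.
move=> v; rewrite mulmx1 mxE sumr_ge0 // => i _.
by rewrite !mxE mulrC mul_conjC_ge0.
Qed.

(** With [z = x - y], testing against [vadj z] gives trace zero to the positive element
    [vmul z (vadj z)], and faithfulness applies. *)
Lemma tau_nondegenerate (x y : M) :
  (forall z, tau (vmul x z) = tau (vmul y z)) -> x = y.
Proof.
have [_ _ _ faith] := trM.
move=> eqxy; pose z := x - y.
have zE w : tau (vmul z w) = 0.
  have -> : z = (-1) *: y + x by rewrite scaleN1r addrC.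
  by rewrite vmul_linear_l // tau_linear eqxy mulN1r addNr.
suff /eqP : z = 0 by rewrite subr_eq0 => /eqP.
apply: opof_inj; apply: mulmx_adj_eq0; rewrite -opof_vadj // -opof_vmul //.
rewrite (faith (vmul z (vadj z))) ?zE // /vpos opof_vmul // opof_vadj //.
have := psdmx_conj ((opof z)^t* ) (@psdmx1 _).
by rewrite trmxCK mulmx1.
Qed.

(** By traciality the value is the trace of the compression [p x p], which is positive. *)
Lemma tau_projection_ge0 (p x : M) :
  opof p *m opof p = opof p -> (opof p)^t* = opof p -> vpos x ->
  0 <= tau (vmul p x).
Proof.
move=> pp pa px; have [_ cyc pos _] := trM.
have -> : tau (vmul p x) = tau (vmul (vmul p x) p).
  rewrite [RHS]cyc; congr tau; apply: opof_inj.
  by rewrite !opof_vmul // mulmxA pp.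
apply: pos; rewrite /vpos !opof_vmul // -{1}pa.
exact: psdmx_conj.
Qed.

End FaithfulTrace.

Section Convolution.
Variables (M : tvna R) (Delta : M -> tens M M) (S : M -> M).
Variable conv : M -> M -> M.
Hypothesis HM : quantum_hypergroup Delta S conv.

Let vnaM : is_vna M := qh_vna HM.
Let trM : is_faithful_trace M := qh_trace HM.
Let linDelta : linear Delta := (qh_Delta_cp HM).1.

(** [1 S(1) = S(S(1)) S(1) = S(1 S(1)) = S(S(1)) = 1]. *)
Lemma S_vone : S (vone M) = vone M.
Proof.
have mul1 (x : M) : vmul (vone M) x = x.
  by apply: opof_inj; rewrite opof_vmul // opof_vone // mul1mx.
rewrite -[LHS]mul1 -{1}[vone M](qh_S_involutive HM) -(qh_S_anti HM) mul1.
exact: qh_S_involutive HM _.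
Qed.

(** Cyclic symmetry moves the coproduct off [h]: here it falls on [x], and in [tau_conv_l] on
    [p]. *)
Lemma tau_conv_r (p x h : M) :
  tau (vmul (conv p x) (S h)) = tau (vmul (vtens (S p) (S h)) (Delta x)).
Proof. by rewrite -(qh_cyclic HM) (qh_conv HM). Qed.

Lemma tau_conv_l (p x h : M) :
  tau (vmul (conv p x) (S h)) = tau (vmul (vtens (S h) (S x)) (Delta p)).
Proof. by rewrite -(qh_conv HM) (qh_cyclic HM). Qed.

Lemma conv_nondegenerate (x y : M) :
  (forall h, tau (vmul x (S h)) = tau (vmul y (S h))) -> x = y.
Proof.
move=> eqxy; apply: tau_nondegenerate => // z.
by rewrite -[z](qh_S_involutive HM).
Qed.

Lemma tau_unit_vtens (a b : M) :
  tau (vmul (vtens a b) (vone (tens M M))) = tau a * tau b.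
Proof.
rewrite vone_tens ?opof_vone // vmul_vtens // tau_vtens //; try exact: tau_linear.
have mul1 (x : M) : vmul x (vone M) = x.
  by apply: opof_inj; rewrite opof_vmul // opof_vone // mulmx1.
by rewrite !mul1.
Qed.

(** Test against the unit, which [S] fixes and whose coproduct is [1 (x) 1]. *)
Lemma tau_conv (p x : M) : tau (conv p x) = tau p * tau x.
Proof.
have -> : conv p x = vmul (conv p x) (S (vone M)).
  by apply: opof_inj; rewrite S_vone opof_vmul // opof_vone // mulmx1.
rewrite (qh_conv HM) (qh_Delta_unital HM) tau_unit_vtens.
by rewrite !(qh_S_trace HM) mulrC.
Qed.

(** With the coproduct falling on the unit, the pairing factors through the two traces. This is the
    source of the flatness condition [fm_flat]. *)
Lemma conv_vone (x : M) : conv (vone M) x = tau x *: vone M.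
Proof.
apply: conv_nondegenerate => h.
rewrite tau_conv_l (qh_Delta_unital HM) tau_unit_vtens.
have -> : vmul (tau x *: vone M) (S h) = tau x *: S h.
  apply: opof_inj; rewrite opof_vmul // /opof !linearZ /= -/(opof _) opof_vone //.
  by rewrite -scalemxAl mul1mx.
by rewrite (linear_scale (V := C^o) _ _ (tau_linear trM)) !(qh_S_trace HM) mulrC.
Qed.

Lemma conv_linear_l (x : M) : linear (conv ^~ x).
Proof.
move=> c p q; apply: conv_nondegenerate => h.
rewrite vmul_linear_l tau_linear // !tau_conv_r.
by rewrite (qh_S_linear HM) vtens_linear_l vmul_linear_l tau_tens_linear.
Qed.

Lemma conv_linear_r (p : M) : linear (conv p).
Proof.
move=> c x y; apply: conv_nondegenerate => h.
rewrite vmul_linear_l tau_linear // !tau_conv_r.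
by rewrite linDelta vmul_linear_r tau_tens_linear.
Qed.

(** [conv p x] is the slice of [Delta x] by the functional [tau (S p _)] on the first leg. That
    slice is [W]; a check on elementary tensors shows that it has the right pairing with every
    [S h], and the trace is nondegenerate. *)
Lemma opof_conv (p x : M) k l :
  opof (conv p x) k l = tau (vmul (S p) (lslice k l (Delta x))).
Proof.
set q := S p.
have lin k' l' : linear (fun Z : tens M M => tau (vmul q (lslice k' l' Z)) : C^o).
  by move=> c X Y; rewrite lslice_linear vmul_linear_r tau_linear.
pose W (Z : tens M M) : M :=
  toelt M (\matrix_(k, l) tau (vmul q (lslice k l Z))).
have WE a b : W (vtens a b) = tau (vmul q a) *: b.
  rewrite -[b in RHS]toeltK -[RHS](linearZ_LR (vsproj (tcarrier M))).
  congr toelt; apply/matrixP => i j; rewrite !mxE lslice_vtens.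
  rewrite (linear_scale _ _ (@vmul_linear_r _ M q)).
  by rewrite (linear_scale (V := C^o) _ _ (tau_linear trM)) [LHS]mulrC.
have Wlin : linear W.
  move=> c X Y; rewrite /W -toelt_linear; congr toelt.
  by apply/matrixP => i j; rewrite !mxE; exact: lin.
have -> : conv p x = W (Delta x).
  apply: conv_nondegenerate => h; rewrite tau_conv_r.
  move: (Delta x); apply: (tens_ext (V := C^o)) => [c X Y|c X Y|a b].
  - by rewrite vmul_linear_r tau_tens_linear.
  - by rewrite Wlin vmul_linear_l tau_linear.
  - rewrite vmul_vtens // tau_vtens //; try exact: tau_linear.
    rewrite WE (linear_scale _ _ (@vmul_linear_l _ M (S h))).
    rewrite (linear_scale (V := C^o) _ _ (tau_linear trM)).
    by case: trM => _ cyc _ _; rewrite (cyc b).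
move: (Delta x) k l => Z k l.
move: Z; apply: (tens_ext (V := C^o)) => [c X Y|c X Y|a b].
- by rewrite Wlin opof_entry_linear.
- exact: lin.
- rewrite WE lslice_vtens (linear_scale _ _ (@vmul_linear_r _ M q)).
  rewrite (linear_scale (V := C^o) _ _ (tau_linear trM)).
  by rewrite /opof linearZ mxE [LHS]mulrC.
Qed.

(* The quadratic form of the slices of a positive kernel at v is the functional
   [tau (S p _)] of the compression of that kernel by v, which is positive. *)
Lemma cp_conv (p : M) :
  opof p *m opof p = opof p -> (opof p)^t* = opof p -> cp_kernel (conv p).
Proof.
move=> pp pa I x psdx v.
have := cp_kernelP (qh_Delta_cp HM) psdx => psdD.
(* Since [S] is an antiautomorphism commuting with the adjoint, [q] is again a self-adjoint
   projection. *)
set q := S p.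
have qq : opof q *m opof q = opof q.
  rewrite -opof_vmul // -(qh_S_anti HM); congr (opof (S _)).
  by apply: opof_inj; rewrite opof_vmul.
have qa : (opof q)^t* = opof q.
  rewrite -opof_vadj // -(qh_S_adj HM); congr (opof (S _)).
  by apply: opof_inj; rewrite opof_vadj.
pose T := (I * 'I_(tdim M))%type.
pose y (s t : T) : M := lslice s.2 t.2 (Delta (x s.1 t.1)).
pose Y : M := \sum_(st : T * T) ((v st.1)^* * v st.2) *: y st.1 st.2.
have -> : \sum_s \sum_t (v s)^* * opof (conv p (x s.1 t.1)) s.2 t.2 * v t =
    tau (vmul q Y).
  have qlin : linear (fun z : M => tau (vmul q z) : C^o).
    by move=> c a b; rewrite vmul_linear_r tau_linear.
  rewrite (linear_sumZ (V := C^o) _ _ qlin) -(pair_bigA _ (fun s t =>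
    (v s)^* * v t * tau (vmul q (y s t)))) /=.
  apply: eq_bigr => s _; apply: eq_bigr => t _.
  by rewrite opof_conv mulrAC.
(* The form of [Y] at [u] is the form of the kernel of [Delta] at the product of [v] and [u], with
   the indices reordered. *)
apply: tau_projection_ge0 => //; apply/psdmxE => u.
have := psdD; move/(psdker_comp (fun w : T * 'I_(tdim M) =>
  (w.1.1, mxtens_index (w.2, w.1.2)))).
move/(_ (fun w => v w.1 * u w.2)); congr (0 <= _).
rewrite -(pair_bigA _ (fun s i => \sum_(w : T * 'I_(tdim M)) (v s * u i)^* *
  opof (Delta (x s.1 w.1.1)) (mxtens_index (i, s.2))
    (mxtens_index (w.2, w.1.2)) * (v w.1 * u w.2))) /=.
rewrite exchange_big; apply: eq_bigr => i _ /=.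
under eq_bigr do rewrite -(pair_bigA _ (fun t j => (v _ * u i)^* *
  opof (Delta (x _.1 t.1)) (mxtens_index (i, _.2))
    (mxtens_index (j, t.2)) * (v t * u j))) /= exchange_big.
rewrite exchange_big; apply: eq_bigr => j _ /=.
rewrite /Y (linear_sumZ _ _ (@opof_linear _ M)) summxE.
rewrite -(pair_bigA _ (fun s t => (((v s)^* * v t) *: opof (y s t)) i j)) /=.
rewrite mulr_sumr mulr_suml; apply: eq_bigr => s _.
rewrite mulr_sumr mulr_suml; apply: eq_bigr => t _.
by rewrite mxE opof_lslice rmorphM /=; ring.
Qed.

End Convolution.
End Hypergroup.

(** * Mixtures flattening to the trace *)

Section Mixture.
Variable R : realType.
Local Notation C := R[i].
Local Open Scope complex_scope.

(** The features of the decomposition of a convolution map that pass to tensor products. By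
    [fm_flat], replacing every [L j] by 1 turns [T] into the completely depolarizing map; [fm_wL1]
    encodes trace preservation of [T]. *)
Record flat_mixture (N : tvna R) (T : N -> N) (J : finType)
    (L w : J -> R) (Psi : J -> N -> N) : Prop := FlatMixture {
  fm_linear : linear T;
  fm_ge0 : forall j, 0 <= L j;
  fm_Psi_linear : forall j, linear (Psi j);
  fm_Psi_cp : forall j, cp_kernel (Psi j);
  fm_tau : forall j x, tau (Psi j x) = (w j)%:C * tau x;
  fm_flat : forall x, \sum_j Psi j x = tau x *: vone N;
  fm_sum : forall x, T x = \sum_j (L j)%:C *: Psi j x;
  fm_w1 : \sum_j w j = 1;
  fm_wL1 : \sum_j w j * L j = 1 }.

Lemma sumr_linear (U V : lmodType C) (I : finType) (phi : U -> V) (u : I -> U) :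
  linear phi -> phi (\sum_i u i) = \sum_i phi (u i).
Proof.
move=> lin; have := linear_sumZ (fun=> 1) u lin.
under eq_bigr do rewrite scale1r.
by move=> ->; under eq_bigr do rewrite scale1r.
Qed.

Lemma tau_cplx_linear : scalar (@tau R (cplx R)).
Proof. by move=> c x y; rewrite /tau /= !linearP. Qed.

Lemma tau_tpow_linear (M : tvna R) n : scalar (@tau R (tpow M n)).
Proof. by case: n => [|n]; [exact: tau_cplx_linear | exact: tau_tens_linear]. Qed.

Lemma opof_vone_tpow (M : tvna R) n :
  opof (vone M) = 1%:M -> opof (vone (tpow M n)) = 1%:M.
Proof.
move=> M1; elim: n => [|n IH /=]; first exact: (opofK (M := cplx R) (memvf _)).
by rewrite vone_tens // opof_vone_vtens.
Qed.

Lemma flat_mixture_cplx :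
  flat_mixture (N := cplx R) id (fun _ : unit => 1) (fun=> 1) (fun=> id).
Proof.
split=> //.
- by move=> _ I x.
- by move=> _ x; rewrite mul1r.
- move=> x; rewrite big_const card_unit /= addr0.
  have E : opof (tau x *: vone (cplx R)) = tau x *: 1%:M.
    rewrite {1}/opof linearZ /= -/(opof _); congr (_ *: _).
    exact: (opofK (M := cplx R) (memvf _)).
  apply: (@opof_inj _ (cplx R)); apply: etrans (esym E); apply/matrixP => i j.
  by rewrite !ord1 !mxE eqxx mulr1 /tau /= /mxtrace big_ord1.
- by move=> x; rewrite big_const card_unit /= addr0 scale1r.
- by rewrite big_const card_unit /= addr0.
- by rewrite big_const card_unit /= addr0 mulr1.
Qed.

(** Indices are paired and weights multiplied; the identities between maps are checked on elementary
    tensors, and complete positivity is [cp_kernel_tens_map]. *)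
Lemma flat_mixture_tens (M N : tvna R) (T : M -> M) (T' : N -> N)
    (J J' : finType) (L w : J -> R) (L' w' : J' -> R) Psi Psi' :
  scalar (@tau R M) -> scalar (@tau R N) ->
  opof (vone M) = 1%:M -> opof (vone N) = 1%:M ->
  flat_mixture T L w Psi -> flat_mixture T' L' w' Psi' ->
  flat_mixture (N := tens M N) (tens_map T T')
    (fun p : J * J' => L p.1 * L' p.2) (fun p => w p.1 * w' p.2)
    (fun p => tens_map (Psi p.1) (Psi' p.2)).
Proof.
move=> tM tN M1 N1 F F'.
have tlin := @tau_tens_linear R M N.
have splitl (a b : C) : linear (fun X : tens M N => a * b * tau X : C^o).
  by move=> c X Y; rewrite tlin mulrDr mulrCA.
split.
- exact: tens_map_linear.
- by move=> j; rewrite mulr_ge0 // (fm_ge0 F, fm_ge0 F').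
- by move=> j; exact: tens_map_linear.
- by move=> j; apply: cp_kernel_tens_map;
    (apply: (fm_Psi_linear F) || apply: (fm_Psi_linear F') ||
     apply: (fm_Psi_cp F) || apply: (fm_Psi_cp F')).
- move=> [i j]; rewrite rmorphM; cbn [fst snd].
  apply: (tens_ext (V := C^o)) => [c X Y||x y].
  + by rewrite tens_map_linear tlin.
  + exact: splitl.
  + rewrite tens_map_vtens ?tau_vtens //;
      try (exact: (fm_Psi_linear F) || exact: (fm_Psi_linear F')).
    by rewrite (fm_tau F) (fm_tau F') mulrACA.
- apply: tens_ext => [c X Y|c X Y|x y].
  + rewrite scaler_sumr -big_split; apply: eq_bigr => j _ /=.
    by rewrite tens_map_linear.
  + by rewrite tlin scalerDl -scalerA.
  + rewrite vone_tens // tau_vtens //.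
    transitivity (\sum_p vtens (Psi p.1 x) (Psi' p.2 y)).
      apply: eq_bigr => p _; rewrite tens_map_vtens //.
      * exact: (fm_Psi_linear F).
      * exact: (fm_Psi_linear F').
    rewrite -(pair_bigA _ (fun i j => vtens (Psi i x) (Psi' j y))) /=.
    under eq_bigr do
      rewrite -(sumr_linear _ (@vtens_linear_r _ M N _)) (fm_flat F').
    rewrite -(sumr_linear _ (@vtens_linear_l _ M N _)) (fm_flat F).
    rewrite (linear_scale _ _ (@vtens_linear_l _ M N _)).
    by rewrite (linear_scale _ _ (@vtens_linear_r _ M N _)) scalerA.
- apply: tens_ext => [||x y].
  + exact: tens_map_linear.
  + move=> c X Y; rewrite scaler_sumr -big_split; apply: eq_bigr => j _ /=.
    by rewrite tens_map_linear scalerDr !scalerA [_ * c]mulrC.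
  + rewrite tens_map_vtens; [|exact: (fm_linear F)|exact: (fm_linear F')].
    rewrite (fm_sum F) (fm_sum F').
    rewrite (linear_sumZ _ _ (@vtens_linear_l _ M N _)).
    under eq_bigr do rewrite (linear_sumZ _ _ (@vtens_linear_r _ M N _)) scaler_sumr.
    rewrite pair_big; apply: eq_bigr => p _ /=.
    rewrite scalerA rmorphM tens_map_vtens //.
    * exact: (fm_Psi_linear F).
    * exact: (fm_Psi_linear F').
- rewrite -(pair_bigA _ (fun i j => w i * w' j)) /=.
  under eq_bigr do rewrite -mulr_sumr (fm_w1 F') mulr1.
  exact: fm_w1 F.
- rewrite -(pair_bigA _ (fun i j => w i * w' j * (L i * L' j))) /=.
  under eq_bigr do under eq_bigr do rewrite mulrACA.
  under eq_bigr do rewrite -mulr_sumr (fm_wL1 F') mulr1.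
  exact: fm_wL1 F.
Qed.

(** A Leibniz rule for [x log2 x], the source of the additivity of entropy under tensor products;
    both sides vanish when a factor is zero. *)
Lemma xlog2xM (x y : R) : 0 <= x -> 0 <= y ->
  x * y * log2 (x * y) = y * (x * log2 x) + x * (y * log2 y).
Proof.
rewrite !le_eqVlt => /predU1P[<-|x0] /predU1P[<-|y0];
  rewrite ?(mul0r, mulr0, addr0) //.
by rewrite /log2 lnM ?posrE // mulrDl; ring.
Qed.

Lemma flat_mixture_tpow (M : tvna R) (T : M -> M) (J : finType)
    (L w : J -> R) Psi n :
  scalar (@tau R M) -> opof (vone M) = 1%:M -> flat_mixture T L w Psi ->
  exists (J' : finType) (L' w' : J' -> R) Psi',
    flat_mixture (@tpow_map R M M T n) L' w' Psi' /\
    \sum_j w' j * (L' j * log2 (L' j)) =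
    n%:R * \sum_j w j * (L j * log2 (L j)).
Proof.
move=> tM M1 F; elim: n => [|n [J' [L' [w' [Psi' [F' hF']]]]]].
  exists unit, (fun=> 1), (fun=> 1), (fun=> id); split.
    exact: flat_mixture_cplx.
  by rewrite big_const card_unit /= /log2 ln1 mul0r !mulr0 mul0r addr0.
exists (J * J')%type, (fun p => L p.1 * L' p.2), (fun p => w p.1 * w' p.2).
exists (fun p => tens_map (Psi p.1) (Psi' p.2)); split.
  apply: flat_mixture_tens => //; first exact: tau_tpow_linear.
  exact: opof_vone_tpow.
rewrite -(pair_bigA _ (fun i j => w i * w' j * (L i * L' j * log2 (L i * L' j)))) /=.
(* The normalizations [fm_wL1] of both factors reduce the double sum to the sum of the two entropy
   sums. *)
under eq_bigr => i _.
  under eq_bigr => j _.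
    rewrite xlog2xM ?(fm_ge0 F) ?(fm_ge0 F') // mulrDr.
    rewrite (_ : _ * _ * (L' j * _) =
      w i * (L i * log2 (L i)) * (w' j * L' j)); last ring.
    rewrite (_ : _ * _ * (L i * _) =
      w i * L i * (w' j * (L' j * log2 (L' j)))); last ring.
    over.
  rewrite big_split /= -!mulr_sumr (fm_wL1 F') mulr1 hF'.
  over.
rewrite big_split /= -mulr_suml (fm_wL1 F) mul1r -[in RHS]addn1 natrD mulrDl mul1r.
by rewrite addrC.
Qed.

End Mixture.

Section ConvMixture.
Variable R : realType.
Local Notation C := R[i].
Local Open Scope complex_scope.

Lemma sum_real_complex (I : finType) (a : I -> R) (z : I -> C) :
  (forall i, z i = (a i)%:C) -> \sum_i z i = (\sum_i a i)%:C.
Proof. by move=> E; rewrite rmorph_sum; apply: eq_bigr. Qed.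

(** The weights [w j] are the traces of the spectral projections [P j] of [f], and [Psi j] convolves
    with [P j]. The two normalizations come from [tau 1 = 1] and [tau f = 1], and flatness comes
    from [sum_j P j = 1] through [conv_vone]. *)
Lemma flat_mixture_conv (M : tvna R) (Delta : M -> tens M M) (S : M -> M)
    (conv : M -> M -> M) (f : M) :
  quantum_hypergroup Delta S conv -> tau (vone M) = 1 -> vpos f ->
  tau f = 1 ->
  exists (J : finType) (L w : J -> R) Psi,
    [/\ flat_mixture (conv f) L w Psi, forall j, 0 <= w j &
        tau (xlog2x f) = (\sum_j w j * (L j * log2 (L j)))%:C].
Proof.
move=> HM tau1 Hf tauf.
have vnaM := qh_vna HM; have trM := qh_trace HM.
have taulin := tau_linear trM.
have [J [L [P [L0 Pproj P1 fE hE]]]] := spectral_resolution vnaM Hf.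
have tauP0 j : 0 <= tau (P j).
  have -> : tau (P j) = tau (vmul (P j) (vone M)).
    congr tau; apply: opof_inj.
    by rewrite (opof_vmul vnaM) (opof_vone vnaM) mulmx1.
  have [pp pa] := Pproj j; apply: (tau_projection_ge0 vnaM trM pp pa).
  by rewrite /vpos (opof_vone vnaM); exact: psdmx1.
pose w j := complex.Re (tau (P j)).
have wE j : tau (P j) = (w j)%:C by rewrite /w RRe_real ?ger0_real.
have tausum (a : J -> R) :
    tau (\sum_j (a j)%:C *: P j) = (\sum_j w j * a j)%:C.
  rewrite (linear_sumZ (V := C^o) _ _ taulin).
  apply: sum_real_complex => j.
  by rewrite wE -[LHS]rmorphM mulrC.
have w1 : \sum_j w j = 1.
  suff: (\sum_j w j)%:C = 1 :> C by case.
  rewrite -tau1 -P1 (sumr_linear (V := C^o) _ taulin).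
  by symmetry; exact: sum_real_complex.
have wL1 : \sum_j w j * L j = 1.
  suff: (\sum_j w j * L j)%:C = 1 :> C by case.
  by rewrite -tausum -fE tauf.
exists J, L, w, (fun j => conv (P j)); split.
- split=> //.
  + exact: conv_linear_r HM f.
  + by move=> j; exact: conv_linear_r HM (P j).
  + by move=> j; have [pp pa] := Pproj j; exact (cp_conv HM pp pa).
  + by move=> j x; rewrite (tau_conv HM) wE.
  + move=> x; rewrite -(conv_vone HM) -P1.
    by rewrite -(sumr_linear _ (conv_linear_l HM x)).
  + move=> x; rewrite {1}fE.
    exact: (linear_sumZ _ _ (conv_linear_l HM x)).
- by move=> j; have := tauP0 j; rewrite wE ler0c.
- by rewrite hE tausum.
Qed.

End ConvMixture.

(** * Entropy inequalities *)

Section Entropy.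
Variable R : realType.

(** The exponential lies above its tangent line: [e^s = x e^(s - ln x) >= x (1 + s - ln x)] for
    [x > 0], while at [x = 0] only [e^s >= 0] remains. *)
Lemma young_ln (s x : R) : 0 <= x -> 0 <= x * ln x - x + expR s - s * x.
Proof.
rewrite le_eqVlt => /predU1P[<-|x0].
  by rewrite mul0r mulr0 !subr0 add0r expR_ge0.
have : x * (1 + (s - ln x)) <= expR s.
  have -> : expR s = x * expR (s - ln x).
    by rewrite expRD expRN lnK ?posrE // mulrC mulfVK ?lt0r_neq0.
  rewrite ler_wpM2l ?(ltW x0) //. exact: expR_ge1Dx.
by move=> h; lra.
Qed.

Lemma ln2_gt0 : 0 < ln (2 : R).
Proof. by rewrite ln_gt0 // ltr1n. Qed.

(* Both sides of the pointwise inequality [s L u <= w (L ln L - L + 1) + u (e^s - 1)]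
   are affine in u, so that Young's inequality at u = 0 and u = w suffices. *)
Lemma mixture_test_bound (J : finType) (L w u : J -> R) (m : nat) (d : R) :
  (forall j, 0 <= L j) -> (forall j, 0 <= u j <= w j) ->
  \sum_j w j = 1 -> \sum_j w j * L j = 1 ->
  \sum_j u j <= (2 ^+ m)^-1 -> 1 - d <= \sum_j L j * u j ->
  (1 - d) * m%:R * ln 2 <= (\sum_j w j * (L j * log2 (L j))) * ln 2 + 1.
Proof.
move=> L0 uw w1 wL1 usmall ubig.
(* This choice gives [e^s = 2^m], matching the bound on [sum_j u j]. *)
pose s : R := ln 2 *+ m.
have es : expR s = 2 ^+ m by rewrite /s -lnXn // lnK // posrE exprn_gt0.
have s0 : 0 <= s by rewrite mulrn_wge0 // ltW // ln2_gt0.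
have ptwise j : s * (L j * u j) <=
    w j * (L j * log2 (L j)) * ln 2 - w j * L j + w j + u j * (expR s - 1).
  have /andP[u0 uw'] := uw j.
  have := young_ln s (L0 j); have := young_ln 0 (L0 j).
  rewrite expR0 mul0r subr0 => a b.
  have -> : w j * (L j * log2 (L j)) * ln 2 = w j * (L j * ln (L j)).
    by rewrite /log2 -!mulrA mulVf ?mulr1 // lt0r_neq0 // ln2_gt0.
  have uw0 : 0 <= w j - u j by rewrite subr_ge0.
  (* Young's inequality at 0 with weight [w j - u j], plus the one at [s] with weight [u j]. *)
  have := mulr_ge0 uw0 a; have := mulr_ge0 u0 b; lra.
have : \sum_j s * (L j * u j) <= \sum_j (w j * (L j * log2 (L j)) * ln 2
    - w j * L j + w j + u j * (expR s - 1)) by apply: ler_sum => j _.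
rewrite -mulr_sumr !big_split sumrN -!mulr_suml /= w1 wL1 es => h.
have h1 : s * (1 - d) <= s * \sum_j L j * u j by exact: ler_wpM2l.
(* The origin of the additive constant: [2^-m (2^m - 1) <= 1]. *)
have h2 : (\sum_j u j) * (2 ^+ m - 1) <= 1.
  apply: (le_trans (ler_wpM2r _ usmall)).
    by rewrite subr_ge0 exprn_ege1 // ler1n.
  by rewrite mulrBr mulVf ?expf_neq0 // mulr1 gerBl invr_ge0 exprn_ge0.
have -> : (1 - d) * m%:R * ln 2 = s * (1 - d) by rewrite /s -mulr_natl; ring.
lra.
Qed.

(** Young's inequality at [s = 0] makes each [w (L ln L - L + 1)] nonnegative, and the two
    normalizations cancel the linear terms. *)
Lemma mixture_entropy_ge0 (J : finType) (L w : J -> R) :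
  (forall j, 0 <= L j) -> (forall j, 0 <= w j) ->
  \sum_j w j = 1 -> \sum_j w j * L j = 1 ->
  0 <= \sum_j w j * (L j * log2 (L j)).
Proof.
move=> L0 w0 w1 wL1.
have : 0 <= \sum_j (w j * (L j * log2 (L j)) * ln 2 - w j * L j + w j).
  apply: sumr_ge0 => j _; have := young_ln 0 (L0 j).
  rewrite expR0 mul0r subr0 => a.
  have -> : w j * (L j * log2 (L j)) * ln 2 = w j * (L j * ln (L j)).
    by rewrite /log2 -!mulrA mulVf ?mulr1 // lt0r_neq0 // ln2_gt0.
  by have := mulr_ge0 (w0 j) a; lra.
rewrite !big_split sumrN -mulr_suml /= w1 wL1 subrK.
by rewrite pmulr_lge0 // ln2_gt0.
Qed.

End Entropy.

(** * Codes and completely bounded norms *)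

Section Coding.
Variable R : realType.
Local Notation C := R[i].
Local Open Scope complex_scope.
Local Notation normc := ComplexField.Normc.normc.

Lemma sum_mxtens_index (V : nmodType) k d (F : 'I_(k * d) -> V) :
  \sum_s F s = \sum_i \sum_j F (mxtens_index (i, j)).
Proof.
rewrite pair_big /= (reindex (@mxtens_index k d)) /=.
  by apply: eq_bigr => -[].
exists (@mxtens_unindex k d) => s _; [exact: mxtens_indexK | exact: mxtens_unindexK].
Qed.

Lemma normc_ge0 (z : C) : 0 <= normc z.
Proof. by case: z => a b /=; rewrite sqrtr_ge0. Qed.

Lemma normc_ge_absRe (z : C) : `|complex.Re z| <= normc z.
Proof.
by case: z => a b /=; rewrite -sqrtr_sqr ler_wsqrtr // lerDl sqr_ge0.
Qed.

(** Extending a vector by zero along [iota] preserves its norm, and the submatrix acts as the full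
    matrix followed by restriction to the image of [iota]. *)
Lemma opnorm_mxsub_le m d (iota : 'I_m -> 'I_d) (X : 'M[C]_d) :
  injective iota -> (opnorm (mxsub iota iota X) <= opnorm X)%E.
Proof.
move=> inj; apply: ge_ereal_sup => _ [v v1 <-].
pose u : 'cV[C]_d := \col_t \sum_(s | iota s == t) v s 0.
have uE s : u (iota s) 0 = v s 0.
  rewrite mxE (bigD1 s) //= big1 ?addr0 // => s' /andP[/eqP/inj -> ].
  by rewrite eqxx.
have u0 t : t \notin codom iota -> u t 0 = 0.
  move=> ht; rewrite mxE big1 // => s /eqP E.
  by rewrite -E codom_f in ht.
have sum_iota (V : nmodType) (F : 'I_d -> V) :
    \sum_(t in codom iota) F t = \sum_s F (iota s).
  rewrite [RHS](partition_big iota (mem (codom iota))) /= => [|s _]; last first.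
    exact: codom_f.
  apply: eq_bigr => t /codomP[s ->]; rewrite (big_pred1 s) // => s' /=.
  by rewrite (inj_eq inj).
have vu : vnorm u = vnorm v.
  rewrite /vnorm; congr Num.sqrt.
  rewrite (bigID (mem (codom iota))) /= [X in _ + X]big1 ?addr0; last first.
    by move=> t ht; rewrite u0 // ComplexField.Normc.normc0 expr0n.
  by rewrite sum_iota; apply: eq_bigr => s _; rewrite uE.
have XE s : (mxsub iota iota X *m v) s 0 = (X *m u) (iota s) 0.
  rewrite !mxE [RHS](bigID (mem (codom iota))) /= [X in _ + X]big1 ?addr0; last first.
    by move=> t ht; rewrite u0 // mulr0.
  by rewrite sum_iota; apply: eq_bigr => s' _; rewrite uE mxE.
apply: (@le_trans _ _ (vnorm (X *m u))%:E).
  rewrite lee_fin /vnorm ler_wsqrtr //.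
  rewrite [leRHS](bigID (mem (codom iota))) /= sum_iota.
  under eq_bigr do rewrite XE.
  by rewrite lerDl sumr_ge0 // => t _; rewrite sqr_ge0.
apply: ereal_sup_ubound; exists u => //=.
by rewrite vu.
Qed.

Section Ell.
Variable K : nat.
Local Notation E := (ell R K).

Definition ebasis (x : 'I_K) : E := toelt E (delta_mx x x).

Lemma opof_ebasis x : opof (ebasis x) = delta_mx x x.
Proof. by apply: opofK; apply: memv_span; apply: map_f; rewrite mem_enum. Qed.

Lemma ell_diag (a : E) i j : i != j -> opof a i j = 0.
Proof.
move=> ne; pose S : seq 'M[C]_K := [seq delta_mx i i | i <- enum 'I_K].
have : opof a \in <<in_tuple S>>%VS by exact: valP a.
move/coord_span => ->; rewrite summxE big1 // => s _; rewrite mxE.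
have /mapP[x _ ->] : S`_s \in S by exact: mem_nth.
rewrite mxE; case: eqVneq => [<-|]; rewrite ?mulr0 //=.
by rewrite eq_sym (negPf ne) mulr0.
Qed.

Lemma ellE (a : E) : a = \sum_x opof a x x *: ebasis x.
Proof.
apply: (@opof_inj _ E); rewrite (linear_sumZ _ _ (@opof_linear _ E)).
apply/matrixP => i j; rewrite summxE (bigD1 i) //= big1 => [|x ne].
  rewrite addr0 mxE opof_ebasis mxE eqxx /=.
  have [->|ne] := eqVneq j i; first by rewrite mulr1.
  by rewrite mulr0 ell_diag // eq_sym.
by rewrite mxE opof_ebasis mxE eq_sym (negPf ne) mulr0.
Qed.

Lemma tau_ell (a : E) : tau a = \sum_x opof a x x.
Proof. by []. Qed.

Lemma tau_ell_linear : scalar (@tau R E).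
Proof. by move=> c x y; rewrite /tau /= !linearP. Qed.

Lemma tau_ell0 : tau (0 : E) = 0.
Proof. by rewrite /tau /= !linear0. Qed.

Lemma tau_ebasis x : tau (ebasis x) = 1.
Proof.
rewrite tau_ell opof_ebasis (bigD1 x) //= mxE eqxx big1 ?addr0 // => y ne.
by rewrite mxE (negPf ne).
Qed.

Lemma vmul_ebasis x y : vmul (ebasis x) (ebasis y) = (x == y)%:R *: ebasis x.
Proof.
rewrite /vmul !opof_ebasis mul_delta_mx_cond /ebasis.
by case: eqP => [->|_]; rewrite ?scale1r ?scale0r // mulr0n /toelt linear0.
Qed.

Lemma tau_vmul_ebasis_l x (a : E) : tau (vmul (ebasis x) a) = opof a x x.
Proof.
rewrite {1}[a]ellE (linear_sumZ _ _ (@vmul_linear_r _ E _)).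
rewrite (linear_sumZ (V := C^o) _ _ tau_ell_linear) (bigD1 x) //.
rewrite vmul_ebasis eqxx scale1r tau_ebasis big1 => [|y ne].
  by rewrite [LHS]addr0 [LHS]mulr1.
by rewrite vmul_ebasis eq_sym (negPf ne) scale0r tau_ell0 [LHS]mulr0.
Qed.

Lemma tau_vmul_ebasis_r x (a : E) : tau (vmul a (ebasis x)) = opof a x x.
Proof.
rewrite {1}[a]ellE (linear_sumZ _ _ (@vmul_linear_l _ E _)).
rewrite (linear_sumZ (V := C^o) _ _ tau_ell_linear) (bigD1 x) //.
rewrite vmul_ebasis eqxx scale1r tau_ebasis big1 => [|y ne].
  by rewrite [LHS]addr0 [LHS]mulr1.
by rewrite vmul_ebasis (negPf ne) scale0r tau_ell0 [LHS]mulr0.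
Qed.

(** As an element of the predual, [ebasis x] is the functional [h |-> h_xx]. Its amplification to
    [k x k] blocks extracts the submatrix with rows and columns [(i, x)], which does not increase
    the operator norm. *)
Lemma L1_mxnorms_ebasis x :
  (L1_mxnorms (\matrix_(i < 1, j < 1) ebasis x) <= 1)%E.
Proof.
apply: ge_ereal_sup => _ [k [h [h1 ->]]].
apply: le_trans h1.
pose iota (s : 'I_(k * 1)) : 'I_(k * K) := mxtens_index ((mxtens_unindex s).1, x).
have inj : injective iota.
  move=> s t /(can_inj (@mxtens_indexK _ _)) [].
  by rewrite !divn1 => st; exact: val_inj.
apply: le_trans (opnorm_mxsub_le _ inj); rewrite le_eqVlt; apply/orP; left.
apply/eqP; congr opnorm; apply/matrixP => s t.
rewrite -(mxtens_unindexK s) -(mxtens_unindexK t).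
case: (mxtens_unindex s) (mxtens_unindex t) => i i0 [j j0].
rewrite blockmxE [RHS]mxE /iota !mxtens_indexK blockmxE !mxE.
exact: tau_vmul_ebasis_l.
Qed.

Lemma opnorm_block_ebasis x :
  (opnorm (block (\matrix_(i < 1, j < 1) ebasis x)) <= 1)%E.
Proof.
apply: ge_ereal_sup => _ [v v1 <-]; rewrite lee_fin; apply: le_trans v1.
rewrite /vnorm ler_wsqrtr // !sum_mxtens_index !big_ord1.
have XE i : (block (\matrix_(i < 1, j < 1) ebasis x) *m v)
    (mxtens_index (0, i)) 0 = (i == x)%:R * v (mxtens_index (0, x)) 0.
  rewrite mxE sum_mxtens_index big_ord1.
  have BE j : block (\matrix_(i < 1, j < 1) ebasis x) (mxtens_index (0, i))
      (mxtens_index (0, j)) = ((i == x) && (j == x))%:R.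
    by rewrite [LHS]blockmxE !mxE opof_ebasis mxE.
  rewrite (bigD1 x) //= BE eqxx andbT big1 ?addr0 // => j ne.
  by rewrite BE (negPf ne) andbF mul0r.
apply: ler_sum => i _; rewrite XE.
have [->|ne] := eqVneq i x; first by rewrite mul1r.
by rewrite mul0r ComplexField.Normc.normc0 expr0n sqr_ge0.
Qed.

(** Three nested suprema are bounded below by test objects of block size one: [ebasis x] for the cb
    norm of the map, [ebasis x] again for the predual norm, and the vector 1 for the operator norm.
    What remains is the modulus of [1 - g(e_x)_xx]. *)
Lemma cbnorm_ebasis (g : E -> E) x (d : R) :
  (cbnorm_L1 (fun y : E => (y - g y)%R) < d%:E)%E ->
  1 - d <= complex.Re (opof (g (ebasis x)) x x).
Proof.
move=> gd; pose z := opof (ebasis x - g (ebasis x)) x x.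
suff zd : normc z <= d.
  have zE : z = 1 - opof (g (ebasis x)) x x.
    transitivity (opof (ebasis x) x x - opof (g (ebasis x)) x x).
      by rewrite /z /opof linearB !mxE.
    by rewrite opof_ebasis mxE eqxx.
  have := le_trans (normc_ge_absRe z) zd; rewrite zE.
  case: (opof _ _ _) => a b /=; rewrite ler_norml => /andP[_]; lra.
rewrite -lee_fin; apply: le_trans (ltW gd).
apply: (@le_trans _ _ (L1_mxnorms (map_mx (fun y => y - g y)
   (\matrix_(i < 1, j < 1) ebasis x)))); last first.
  apply: ereal_sup_ubound; exists 1%N, (\matrix_(i < 1, j < 1) ebasis x).
  by split=> //; exact: L1_mxnorms_ebasis.
apply: (@le_trans _ _ (@mx_mxnorms R 1 1 (map_mx (fun h : E =>
   \matrix_(i < 1, j < 1) tau (vmul (map_mx (fun y => y - g y)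
   (\matrix_(i < 1, j < 1) ebasis x) i j) h))
   (\matrix_(i < 1, j < 1) ebasis x)))); last first.
  apply: ereal_sup_ubound; exists 1%N, (\matrix_(i < 1, j < 1) ebasis x).
  by split=> //; exact: opnorm_block_ebasis.
apply: ereal_sup_ubound; exists (const_mx 1) => /=.
  rewrite /vnorm sum_mxtens_index !big_ord1 mxE.
  by rewrite ComplexField.Normc.normc1 expr1n sqrtr1.
rewrite /vnorm sum_mxtens_index !big_ord1 mxE sum_mxtens_index !big_ord1.
rewrite blockmxE !mxE mulr1 sqrtr_sqr ger0_norm ?normc_ge0 //.
by congr ((normc _)%:E); exact: tau_vmul_ebasis_r.
Qed.


End Ell.
End Coding.

(** * Converse bound *)

Section Converse.
Variable R : realType.
Local Notation C := R[i].
Local Open Scope complex_scope.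
Local Open Scope sesquilinear_scope.

Lemma psdmx_diag_ge0 d (X : 'M[C]_d) i : psdmx X -> 0 <= X i i.
Proof.
move=> /(_ (delta_mx i 0)).
by rewrite trmx_delta map_delta_mx -rowE -colE !mxE.
Qed.

Lemma Re_sum (I : finType) (z : I -> C) :
  complex.Re (\sum_i z i) = \sum_i complex.Re (z i).
Proof. by apply: (big_morph (@complex.Re R)) => // -[a b] [a' b']. Qed.

Lemma vpos_ebasis K x : vpos (@ebasis R K x).
Proof.
rewrite /vpos opof_ebasis.
have := psdmx_conj (delta_mx x x) (@psdmx1 R K).
by rewrite trmx_delta map_delta_mx mulmx1 mul_delta_mx.
Qed.

(** Reduces a code to the numerical data of [mixture_test_bound]: since the decoder is a channel,
    the functionals [eta x] are positive and add up to [tau]. *)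
Lemma code_test (N : tvna R) (T : N -> N) (J : finType) (L w : J -> R) Psi
    K (phi1 : ell R K -> N) (phi2 : N -> ell R K) (d : R) :
  flat_mixture T L w Psi -> (0 < K)%N ->
  quantum_channel phi1 -> quantum_channel phi2 ->
  (forall x, 1 - d <= complex.Re (opof (phi2 (T (phi1 (ebasis R x)))) x x)) ->
  exists u : J -> R,
    [/\ forall j, 0 <= u j <= w j, \sum_j u j <= K%:R^-1 &
        1 - d <= \sum_j L j * u j].
Proof.
move=> F K0 [cp1 tr1] [cp2 tr2] good.
have pos1 x : vpos (phi1 (ebasis R x)).
  exact: cp_kernel_pos (cp_kernelP cp1) (vpos_ebasis x).
have tau1 x : tau (phi1 (ebasis R x)) = 1 by rewrite tr1 tau_ebasis.
pose eta x (y : N) : C := opof (phi2 y) x x.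
have eta_lin x : linear (eta x : N -> C^o).
  by move=> c y z; rewrite /eta cp2.1 opof_entry_linear.
have eta_ge0 x y : vpos y -> 0 <= eta x y.
  by move=> py; exact: psdmx_diag_ge0 (cp_kernel_pos (cp_kernelP cp2) py).
have eta_sum y : \sum_x eta x y = tau y by rewrite -tr2 tau_ell.
pose x0 : 'I_K := Ordinal K0.
(* Taking the trace of [fm_flat] at a state turns its left side into [sum_j w j = 1]. *)
have tau_vone : tau (vone N) = 1.
  have := congr1 (fun y => \sum_x eta x y) (fm_flat F (phi1 (ebasis R x0))).
  rewrite !eta_sum tau1 scale1r => <-.
  rewrite -eta_sum; under eq_bigr do rewrite (sumr_linear (V := C^o) _ (eta_lin _)).
  rewrite exchange_big /=; under eq_bigr do rewrite eta_sum (fm_tau F) tau1 mulr1.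
  by rewrite -rmorph_sum (fm_w1 F).
(* Pigeonhole: the [K] values add up to [tau 1 = 1]. *)
have [x xK] : exists x, complex.Re (eta x (vone N)) <= K%:R^-1.
  apply/not_existsP => big.
  have : \sum_(x < K) K%:R^-1 < \sum_x complex.Re (eta x (vone N)).
    apply: ltr_sum => [|x _]; last by rewrite ltNge; apply/negP/big.
    by apply/hasP; exists x0; rewrite // mem_index_enum.
  rewrite sumr_const card_ord -[_ *+ K]mulr_natl mulfV ?pnatr_eq0 -?lt0n //.
  by rewrite -Re_sum eta_sum tau_vone ltxx.
have posPsi j y : vpos y -> vpos (Psi j y) by exact: cp_kernel_pos (fm_Psi_cp F j).
pose rho := phi1 (ebasis R x).
pose u j := complex.Re (eta x (Psi j rho)).
have uE j : eta x (Psi j rho) = (u j)%:C.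
  by rewrite /u RRe_real //; exact/ger0_real/eta_ge0/posPsi/pos1.
exists u; split.
- move=> j; apply/andP; split.
    by rewrite -ler0c -uE; exact/eta_ge0/posPsi/pos1.
  (* [u j] is one of the nonnegative terms that add up to [tau (Psi j rho) = w j]. *)
  rewrite -lecR -uE.
  have -> : (w j)%:C = \sum_x eta x (Psi j rho).
    by rewrite eta_sum (fm_tau F) tau1 mulr1.
  rewrite (bigD1 x) //= lerDl sumr_ge0 // => y _.
  exact/eta_ge0/posPsi/pos1.
- suff -> : \sum_j u j = complex.Re (eta x (vone N)) by [].
  have -> : vone N = \sum_j Psi j rho by rewrite (fm_flat F) tau1 scale1r.
  rewrite (sumr_linear (V := C^o) _ (eta_lin x)).
  by rewrite (sum_real_complex uE).
- suff -> : \sum_j L j * u j = complex.Re (eta x (T rho)) by exact: good.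
  rewrite (fm_sum F) (linear_sumZ (V := C^o) _ _ (eta_lin x)).
  rewrite (@sum_real_complex _ _ (fun j => L j * u j)) // => j.
  by rewrite uE rmorphM.
Qed.

Local Open Scope classical_set_scope.
(** If [a > h], a gap linear in [n] outgrows both the additive constant and the loss from
    truncation. *)
Lemma le_of_asymptotic (a h : R) : 0 <= h ->
  (forall d, 0 < d -> \forall n \near \oo,
     (1 - d) * (Num.truncn (a * n%:R))%:R * ln 2 <= n%:R * h * ln 2 + 1) ->
  a <= h.
Proof.
move=> h0 H; rewrite leNgt; apply/negP => ha.
have a0 : 0 < a by exact: le_lt_trans ha.
have ln2_0 := ln2_gt0 R.
(* Chosen so that [(1 - d) a] is the midpoint of [a] and [h]. *)
pose d := (a - h) / (2 * a).
have d0 : 0 < d by rewrite divr_gt0 ?subr_gt0 ?mulr_gt0.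
have dE : (1 - d) * a = (a + h) / 2 by rewrite /d; field; exact: lt0r_neq0.
have d1 : 0 < 1 - d.
  by rewrite -(pmulr_lgt0 _ a0) dE divr_gt0 // ltr_wpDr.
have [n0 _ Hn0] := H d d0.
(* Beyond [b], the gap [n (a - h) / 2] exceeds [1 / ln 2], due to the additive constant, plus 1,
   which covers the truncation of [a n]. *)
pose b := ((ln 2)^-1 + 1) / ((a - h) / 2).
pose n := maxn n0 (Num.truncn b).+1.
have := Hn0 n (leq_maxl _ _).
have bn : b < n%:R.
  apply: lt_le_trans (_ : (Num.truncn b).+1%:R <= _); last by rewrite ler_nat leq_maxr.
  have b0 : 0 <= b.
    by rewrite /b divr_ge0 ?addr_ge0 ?invr_ge0 ?subr_ge0 ?divr_ge0 ?subr_ge0 ?ltW.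
  by have /andP[] := truncn_itv b0.
have : 0 <= a * n%:R by rewrite mulr_ge0 // ltW.
move/truncn_itv => /andP[_]; rewrite -natr1.
set m := (Num.truncn _)%:R => mn le1.
have h1 : (1 - d) * (a * n%:R - 1) * ln 2 < n%:R * h * ln 2 + 1.
  apply: lt_le_trans le1; rewrite ltr_pM2r // ltr_pM2l //; lra.
have h2 : (ln 2)^-1 + 1 < n%:R * ((a - h) / 2).
  by rewrite -ltr_pdivrMr // divr_gt0 // subr_gt0.
have h3 : 1 + ln 2 < n%:R * ((a - h) / 2) * ln 2.
  move: h2; rewrite -(ltr_pM2r ln2_0) mulrDl mul1r mulVf //.
  exact: lt0r_neq0.
have h4 : (1 - d) * (a * n%:R - 1) * ln 2 =
    n%:R * ((a + h) / 2) * ln 2 - (1 - d) * ln 2 by rewrite -dE; ring.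
have h5 : 0 < d * ln 2 by rewrite mulr_gt0.
by move: h1; rewrite h4; lra.
Qed.

End Converse.

Theorem theorem5p17 (R : realType) (M : tvna R)
    (Delta : M -> tens M M) (S : M -> M) (conv : M -> M -> M)
    (HM : quantum_hypergroup Delta S conv)
    (Htau1 : tau (vone M) = 1)
    (f : M) (Hf : vpos f)
    (HT : quantum_channel (fun x : M => conv f x)) :
  (classical_capacity (fun x : M => conv f x) <= (- segal_entropy f)%:E)%E /\
  real_complex R (- segal_entropy f) = tau (xlog2x f).
Proof.
(* Trace preservation at the unit, since [tau (conv f 1) = tau f]. *)
have tauf : tau f = 1.
  by have := HT.2 (vone M); rewrite (tau_conv HM) Htau1 mulr1.
have [J [L [w [Psi [F w0 hE]]]]] := flat_mixture_conv HM Htau1 Hf tauf.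
have entE : - segal_entropy f = \sum_j w j * (L j * log2 (L j)).
  by rewrite /segal_entropy opprK hE.
split; last by rewrite entE hE.
have h0 := mixture_entropy_ge0 (fm_ge0 F) w0 (fm_w1 F) (fm_wL1 F).
(* The rate zero is settled by nonnegativity of the bound; for a positive rate, the tolerance [d]
   serves as the error allowed to the code. *)
rewrite entE; apply: ge_ereal_sup => _ [a [->|[a0 ach]] <-]; rewrite lee_fin //.
apply: le_of_asymptotic => // d d0.
apply: filterS (ach d d0) => n [phi1 [phi2 [ch1 ch2 cb]]].
have taulin := tau_linear (qh_trace HM).
have one := opof_vone (qh_vna HM).
have [J' [L' [w' [Psi' [F' hE']]]]] := flat_mixture_tpow n taulin one F.
have [|u [uw usmall ubig]] := code_test F' _ ch1 ch2 (fun x => cbnorm_ebasis x cb).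
  by rewrite expn_gt0.
rewrite natrX in usmall.
have := mixture_test_bound (fm_ge0 F') uw (fm_w1 F') (fm_wL1 F') usmall ubig.
by rewrite hE'.
Qed.
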